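(* Let $n \in \mathbb{N}$, $K \subseteq \mathbb{R}^n$ compact, and $\mathcal{H}$ a (real or complex) Hilbert space. Let $T: B(\mathcal{H})_h \otimes \mathbb{R}[x_1, \dots, x_n] \to B(\mathcal{H})_h \otimes \mathbb{R}[x_1, \dots, x_n]$ be a real-linear operator with canonical representation \[ T = \sum_{\alpha \in \mathbb{N}_0^n} \frac{1}{\alpha!}\, Q_\alpha \times \partial^\alpha, \] where $Q_\alpha: B(\mathcal{H})_h \to B(\mathcal{H})_h \otimes \mathbb{R}[x_1, \dots, x_n]$, $\alpha \in \mathbb{N}_0^n$, are linear operators. Then the following are equivalent: (i) $T$ preserves positivity on $K$, i.e. $T\,\mathrm{Pos}(K) \subseteq \mathrm{Pos}(K)$. (ii) For each $y \in K$ there exists a positive map-valued measure $\nu_y: \mathrm{Bor}(K-y) \to \mathcal{L}(B(\mathcal{H})_h, B(\mathcal{H})_h)$ such that \[ Q_\beta(A)(y) = \int_{K-y} t^\beta \,\mathrm{d}\nu_y[A](t) \] for all $A \in B(\mathcal{H})_h$ and all $\beta \in \mathbb{N}_0^n$.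
   Context: $B(\mathcal{H})_h$ denotes the real vector space of bounded self-adjoint operators on $\mathcal{H}$, and $B(\mathcal{H})_{h,+}$ the cone of positive ones ($A \succeq 0$). An operator polynomial is an element $p = \sum_{\alpha \preceq \beta} p_\alpha x^\alpha$ of $B(\mathcal{H})_h \otimes \mathbb{R}[x_1,\dots,x_n]$ with $p_\alpha \in B(\mathcal{H})_h$, viewed as the map $x \mapsto p(x) \in B(\mathcal{H})_h$ on $\mathbb{R}^n$. $\mathrm{Pos}(K) := \{p : p(x) \succeq 0 \text{ for all } x \in K\}$. $K - y := \{k - y : k \in K\}$. Canonical representation: for a linear $T$ on $B(\mathcal{H})_h \otimes \mathbb{R}[x_1,\dots,x_n]$ there are unique linear $Q_\alpha: B(\mathcal{H})_h \to B(\mathcal{H})_h\otimes\mathbb{R}[x_1,\dots,x_n]$ with $T(A \otimes x^\beta) = \sum_{\alpha} \frac{1}{\alpha!} Q_\alpha(A)\, \partial^\alpha x^\beta$ for all $A$, $\beta$; explicitly $Q_\beta(A) = \sum_{\alpha \preceq \beta} \binom{\beta}{\alpha}(-1)^{\beta-\alpha} T(A\otimes x^\alpha)\, x^{\beta-\alpha}$. A positive operator-valued measure on a measurable space $(\mathcal{X},\mathcal{A})$ with values in $B(\mathcal{H})_h$ is a map $\mu:\mathcal{A}\to B(\mathcal{H})_h$ such that $S \mapsto \langle \mu(S)x, x\rangle$ is a finite positive measure for every $x \in \mathcal{H}$; integrals $\int f\,\mathrm{d}\mu \in B(\mathcal{H})_h$ of integrable functions are defined weakly and are linear and positivity preserving.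 A map-valued measure is a map $\mu: \mathcal{A} \to \mathcal{L}(B(\mathcal{H})_h, B(\mathcal{H})_h)$ such that $\mu[A] := \mu(\cdot)(A)$ is an operator-valued measure for every $A \in B(\mathcal{H})_h$; it is positive if $\mu[A]$ is a positive operator-valued measure for every $A \in B(\mathcal{H})_{h,+}$. For $p = A_1 p_1 + \dots + A_m p_m$ with $A_i \in B(\mathcal{H})_h$, $p_i \in \mathbb{R}[x_1,\dots,x_n]$, one sets $\int p\,\mathrm{d}\mu := \sum_i \int p_i \,\mathrm{d}\mu[A_i]$ (independent of the representation). *)

(* Defs.v *)
From HB Require Import structures.
From mathcomp Require Import all_boot all_order all_algebra.
From mathcomp Require Import all_classical all_reals all_analysis.
Set Implicit Arguments. Unset Strict Implicit. Unset Printing Implicit Defensive.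
Import Order.TTheory GRing.Theory Num.Theory.
Import numFieldNormedType.Exports.
Local Open Scope classical_set_scope.
Local Open Scope ring_scope.

(* Hilbert spaces.  A (real or complex) Hilbert space H is encoded as a real  *)
(* inner product space (V, ip) which is complete, together with an optional  *)
(* complex structure J (J = Some j: complex case, ip = Re <.,.>, j = mult. by *)
Section Hilbert.
Variables (R : realType) (V : lmodType R) (ip : V -> V -> R).

Definition hnorm (x : V) : R := Num.sqrt (ip x x).

Definition real_inner_product : Prop :=
  [/\ (forall a x y z, ip (a *: x + y) z = a * ip x z + ip y z),
      (forall x y, ip x y = ip y x),
      (forall x, 0 <= ip x x) &
      (forall x, ip x x = 0 -> x = 0)].

Definition complete_space : Prop :=
  forall u : nat -> V,
    (forall e : R, 0 < e -> exists N, forall m k, (N <= m)%N -> (N <= k)%N ->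
        hnorm (u m - u k) < e) ->
    exists l : V, forall e : R, 0 < e -> exists N, forall m, (N <= m)%N ->
        hnorm (u m - l) < e.

Definition complex_structure (j : V -> V) : Prop :=
  [/\ (forall a x y, j (a *: x + y) = a *: j x + j y),
      (forall x, j (j x) = - x) &
      (forall x y, ip (j x) (j y) = ip x y)].

Definition hilbert_space (J : option (V -> V)) : Prop :=
  [/\ real_inner_product, complete_space &
      (if J is Some j then complex_structure j else True)].

Definition Bh (J : option (V -> V)) (A : V -> V) : Prop :=
  [/\ (forall a x y, A (a *: x + y) = a *: A x + A y),
      (exists C : R, forall x, hnorm (A x) <= C * hnorm x),
      (forall x y, ip (A x) y = ip x (A y)) &
      (if J is Some j then forall x, A (j x) = j (A x) else True)].

Definition psd (A : V -> V) : Prop := forall x, 0 <= ip (A x) x.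

End Hilbert.

(* Operator polynomials B(H)_h (x) R[x_1..x_n], as coefficient functions     *)
(* alpha |-> p_alpha with finite support and coefficients in B(H)_h.         *)
Definition mindex (n : nat) := {ffun 'I_n -> nat}.

Section OpPoly.
Variables (R : realType) (V : lmodType R) (n : nat).

Definition opoly := mindex n -> (V -> V).

Definition zeroop : V -> V := fun _ => 0.

Definition deg_bounded (d : nat) (p : opoly) : Prop :=
  forall al : mindex n, (exists i, (d <= al i)%N) -> p al = zeroop.

Definition is_opoly (ip : V -> V -> R) (J : option (V -> V)) (p : opoly) :=
  (exists d, deg_bounded d p) /\ (forall al, Bh ip J (p al)).

Definition deg_bound (p : opoly) : nat :=
  match pselect (exists d, deg_bounded d p) with
  | left H => projT1 (cid H)
  | right _ => 0%N
  end.

Definition mon_of (d : nat) (a : {ffun 'I_n -> 'I_d}) : mindex n :=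
  [ffun i => nat_of_ord (a i)].

Definition monom (x : 'rV[R]_n) (al : mindex n) : R :=
  \prod_(i < n) (x ord0 i) ^+ (al i).

Definition opeval (p : opoly) (x : 'rV[R]_n) : V -> V :=
  fun v => \sum_(a : {ffun 'I_n -> 'I_(deg_bound p)})
             monom x (mon_of a) *: p (mon_of a) v.

Definition opadd (p q : opoly) : opoly := fun al v => p al v + q al v.
Definition opscale (c : R) (p : opoly) : opoly := fun al v => c *: p al v.

Definition elem (A : V -> V) (be : mindex n) : opoly :=
  fun al => if al == be then A else zeroop.

Definition mulmono (p : opoly) (ga : mindex n) : opoly :=
  fun al => if [forall i, (ga i <= al i)%N]
            then p [ffun i => (al i - ga i)%N] else zeroop.

Definition Pos (ip : V -> V -> R) (J : option (V -> V)) (K : set 'rV[R]_n)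
  (p : opoly) : Prop :=
  is_opoly ip J p /\ forall x, K x -> psd ip (opeval p x).

Definition Qcan (T : opoly -> opoly) (be : mindex n) (A : V -> V) : opoly :=
  fun ga v =>
    \sum_(a : {ffun 'I_n -> 'I_(\max_(i < n) be i).+1}
            | [forall i, (mon_of a i <= be i)%N])
      ((\prod_(i < n) 'C(be i, mon_of a i))%:R
         * (-1) ^+ (\sum_(i < n) (be i - mon_of a i))%N)
      *: mulmono (T (elem A (mon_of a))) [ffun i => (be i - mon_of a i)%N] ga v.

End OpPoly.

Definition Borel (R : realType) (n : nat) :=
  g_sigma_algebraType (@open 'rV[R]_n).

Section Measures.
Variables (R : realType) (n : nat).
Local Notation X := (Borel R n).

Definition signed_measure_on (D : set X) (m : set X -> R) : Prop :=
  forall F : nat -> set X,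
    (forall k, measurable (F k) /\ F k `<=` D) -> trivIset setT F ->
    (fun N => \sum_(k < N) m (F k)) @ \oo --> m (\bigcup_k F k).

Definition jordan_decomp (D : set X) (m : set X -> R)
  (mu1 mu2 : {finite_measure set X -> \bar R}) : Prop :=
  forall S, measurable S -> S `<=` D -> (m S)%:E = (mu1 S - mu2 S)%E.

Definition is_signed_integral (D : set X) (m : set X -> R) (f : X -> R)
  (r : R) : Prop :=
  (exists mu1 mu2, jordan_decomp D m mu1 mu2) /\
  forall mu1 mu2, jordan_decomp D m mu1 mu2 ->
    r%:E = (\int[mu1]_(t in D) (f t)%:E - \int[mu2]_(t in D) (f t)%:E)%E.

Variables (V : lmodType R) (ip : V -> V -> R) (J : option (V -> V)).

Definition pos_map_valued_measure (D : set X) (nu : set X -> (V -> V) -> (V -> V))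
  : Prop :=
  [/\
      (forall S, measurable S -> S `<=` D ->
         (forall A, Bh ip J A -> Bh ip J (nu S A)) /\
         (forall c A B, Bh ip J A -> Bh ip J B ->
            nu S (fun v => c *: A v + B v) = (fun v => c *: nu S A v + nu S B v))),
      (forall A, Bh ip J A -> forall v,
         signed_measure_on D (fun S => ip (nu S A v) v)) &
      (forall A, Bh ip J A -> psd ip A -> forall S, measurable S -> S `<=` D ->
         psd ip (nu S A))].

End Measures.

Definition translate (R : realType) (n : nat) (K : set 'rV[R]_n)
  (y : 'rV[R]_n) : set (Borel R n) :=
  fun t : 'rV[R]_n => exists2 k, K k & t = k - y.

(* Main.v *)
(* For fixed [y] in [K] the functional [p |-> (T p)(y)] is, up to the shift
   [x |-> x - y], a linear map with moments [Q_be(A)(y)].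

   If [T] preserves positivity, then for [A] positive and [v] in the Hilbert
   space the numbers [<Q_be(A)(y) v, v>] form a positive moment functional on
   [K - y], which Riesz' theorem represents by a measure.  That measure is built
   from polynomials alone: uniform limits of polynomials form a vector lattice,
   and the infimum of the functional over increasing sequences covering a set is
   an outer measure.  A finite measure on a compact set is determined by its
   moments, so the values of these measures at a fixed Borel set are linear in
   [A] and quadratic in [v]; the resulting bounded form is an operator.

   Conversely, on a Borel piece [S] of [K - y] of small diameter containing [t],
   the integral of [p(. + y)] is close to [nu(S)(p(t + y))], which is positive
   since [p(t + y)] is; summing over a finite partition of [K - y] gives
   [(T p)(y) >= 0]. *)

(* The canonical coefficient satisfies [Q_be(A)(y) = T(A (x - y)^be)(y)]: its alternating binomial
   sum is the expansion of [(x - y)^be]. So the functional with moments [Q_be(A)(y)] sends [q] to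
   [T(A q(x - y))(y)], and for [A] positive and [q >= 0] on [K - y] the argument [A q(x - y)] lies
   in [Pos K]; this is where the moments get their positivity. The obstacle in the direct
   implication is that the Riesz construction treats one pair [(A, v)] at a time, only for positive
   [A], and returns an infimum with no visible linearity. General [A] is reached as
   [(c id + A) - c id], mixed pairs [(u, v)] by polarisation, and linearity by uniqueness: the sum
   of two Riesz measures is a measure with the summed moments, hence the Riesz measure of these. In
   the converse the scalar measures attached to the coefficients of [p] are only signed. The error
   on a small piece is therefore paid in the total mass of decompositions chosen for one fixed [v],
   which is finite and additive over the pieces. *)
Require Import Defs.
From HB Require Import structures.
From mathcomp Require Import all_boot all_order all_algebra.
From mathcomp Require Import all_classical all_reals all_analysis.
From mathcomp Require Import ring lra.
Import Order.TTheory GRing.Theory Num.Theory.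
Import numFieldNormedType.Exports.
Local Open Scope classical_set_scope.
Local Open Scope ring_scope.

Set Implicit Arguments.
Unset Strict Implicit.
Unset Printing Implicit Defensive.

(** * Uniform limits of polynomials and the extension of a moment functional *)

Lemma le_all_eps_eq0 (R : realType) (a C : R) :
  (forall e : R, 0 < e -> `|a| <= e * C) -> a = 0.
Proof.
move=> h; apply/eqP; rewrite -normr_le0; apply/ler_addgt0Pl => e e0.
rewrite addr0; have C1 : 0 < `|C| + 1 by rewrite ltr_wpDl.
apply: (le_trans (h (e / (`|C| + 1)) _)); first exact: divr_gt0.
rewrite mulrAC ler_pdivrMr // ler_wpM2l ?(ltW e0) //.
by rewrite (le_trans (ler_norm _)) // lerDl.
Qed.

Section PolynomialLists.
Variables (R : realType) (n : nat).
Implicit Types (phi : mindex n -> R) (s t : seq (R * mindex n)).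

(** A list of coefficient-exponent pairs stands for a polynomial. The same sum gives its value at
    [x] for [phi = monom x] and the value of a moment functional for an arbitrary [phi]. *)
Definition lincomb phi s : R := \sum_(a <- s) a.1 * phi a.2.

Lemma lincomb_nil phi : lincomb phi [::] = 0.
Proof. by rewrite /lincomb big_nil. Qed.

Lemma lincomb_cons phi a s : lincomb phi (a :: s) = a.1 * phi a.2 + lincomb phi s.
Proof. by rewrite /lincomb big_cons. Qed.

Lemma lincomb_cat phi s t : lincomb phi (s ++ t) = lincomb phi s + lincomb phi t.
Proof. by rewrite /lincomb big_cat. Qed.

Definition lscale (c : R) s := [seq (c * a.1, a.2) | a <- s].

Lemma lincomb_scale phi c s : lincomb phi (lscale c s) = c * lincomb phi s.
Proof.
by rewrite /lincomb big_map mulr_sumr; apply: eq_bigr => a _; rewrite /= mulrA.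
Qed.

Definition idxD (al be : mindex n) : mindex n := [ffun i => (al i + be i)%N].

Definition lmul s t := [seq (a.1 * b.1, idxD a.2 b.2) | a <- s, b <- t].

Definition idx0 : mindex n := [ffun=> 0%N].

Lemma monom0 (x : 'rV[R]_n) : monom x idx0 = 1.
Proof. by rewrite /monom big1 // => i _; rewrite ffunE expr0. Qed.

Lemma monomD (x : 'rV[R]_n) al be :
  monom x (idxD al be) = monom x al * monom x be.
Proof.
by rewrite /monom -big_split; apply: eq_bigr => i _; rewrite ffunE exprD.
Qed.

Lemma lincomb_mul (x : 'rV[R]_n) s t :
  lincomb (monom x) (lmul s t) = lincomb (monom x) s * lincomb (monom x) t.
Proof.
rewrite /lincomb big_allpairs_dep mulr_suml; apply: eq_bigr => a _.
rewrite mulr_sumr; apply: eq_bigr => b _ /=.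
by rewrite monomD mulrACA.
Qed.

Lemma lincomb_phiD phi psi (c : R) s :
  lincomb (fun be => c * phi be + psi be) s = c * lincomb phi s + lincomb psi s.
Proof.
rewrite /lincomb mulr_sumr -big_split; apply: eq_bigr => a _ /=.
by rewrite mulrDr mulrCA.
Qed.

Definition idx1 (i : 'I_n) : mindex n := [ffun j => (j == i) : nat].

Lemma monom1 (x : 'rV[R]_n) i : monom x (idx1 i) = x ord0 i.
Proof.
rewrite /monom (bigD1 i) //= ffunE eqxx expr1 big1 ?mulr1 // => j ji.
by rewrite ffunE (negbTE ji) expr0.
Qed.

End PolynomialLists.

(** * The uniform closure of the polynomials: an algebra and a vector lattice *)

Section UniformClosure.
Variables (R : realType) (n : nat) (D : set 'rV[R]_n).
Implicit Types f g : 'rV[R]_n -> R.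

Definition approximable f := forall e : R, 0 < e -> exists s,
  forall x, D x -> `|f x - lincomb (monom x) s| <= e.

Lemma approximable_poly s : approximable (fun x => lincomb (monom x) s).
Proof. by move=> e /ltW e0; exists s => x _; rewrite subrr normr0. Qed.

Lemma approximable_ext f g : (forall x, D x -> f x = g x) ->
  approximable f -> approximable g.
Proof.
by move=> fg af e e0; have [s hs] := af e e0; exists s => x Dx; rewrite -fg // hs.
Qed.

Lemma approximable_cst c : approximable (fun=> c).
Proof.
apply: approximable_ext (approximable_poly [:: (c, @idx0 n)]) => x _.
by rewrite lincomb_cons lincomb_nil /= monom0 mulr1 addr0.
Qed.

Lemma approximable_coord i : approximable (fun x => x ord0 i).
Proof.
apply: approximable_ext (approximable_poly [:: (1, idx1 i)]) => x _.
by rewrite lincomb_cons lincomb_nil /= monom1 mul1r addr0.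
Qed.

Lemma approximable_lin c f g : approximable f -> approximable g ->
  approximable (fun x => c * f x + g x).
Proof.
move=> af ag e e0.
have c1 : 0 < `|c| + 1 by rewrite ltr_wpDl.
have e'0 : 0 < e / (`|c| + 1) by exact: divr_gt0.
have [s hs] := af _ e'0; have [t ht] := ag _ e'0.
exists (lscale c s ++ t) => x Dx; rewrite lincomb_cat lincomb_scale.
have -> : c * f x + g x - (c * lincomb (monom x) s + lincomb (monom x) t) =
  c * (f x - lincomb (monom x) s) + (g x - lincomb (monom x) t) by ring.
apply: (le_trans (ler_normD _ _)); rewrite normrM.
apply: (@le_trans _ _ (`|c| * (e / (`|c| + 1)) + e / (`|c| + 1))).
  by apply: lerD; [apply: ler_wpM2l => //; exact: hs|exact: ht].
rewrite -[X in _ + X]mul1r -mulrDl mulrCA divff ?mulr1 //; exact: lt0r_neq0.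
Qed.

Lemma approximableD f g : approximable f -> approximable g ->
  approximable (fun x => f x + g x).
Proof.
move=> af ag; apply: approximable_ext (approximable_lin 1 af ag) => x _.
by rewrite mul1r.
Qed.

Lemma approximableZ c f : approximable f -> approximable (fun x => c * f x).
Proof.
move=> af; apply: approximable_ext (approximable_lin c af (approximable_cst 0)).
by move=> x _; rewrite addr0.
Qed.

Lemma approximableB f g : approximable f -> approximable g ->
  approximable (fun x => f x - g x).
Proof.
move=> af ag; apply: approximable_ext (approximable_lin (-1) ag af) => x _.
by rewrite mulN1r addrC.
Qed.

Lemma approximable_sum (I : Type) (r : seq I) (F : I -> 'rV[R]_n -> R) :
  (forall i, approximable (F i)) -> approximable (fun x => \sum_(i <- r) F i x).
Proof.
move=> aF; elim: r => [|i r IH].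
  by apply: approximable_ext (approximable_cst 0) => x _; rewrite big_nil.
by apply: approximable_ext (approximableD (aF i) IH) => x _; rewrite big_cons.
Qed.

Lemma approximable_unif f : (forall e : R, 0 < e -> exists2 g, approximable g &
  forall x, D x -> `|f x - g x| <= e) -> approximable f.
Proof.
move=> h e e0; have e20 : 0 < e / 2 by rewrite divr_gt0.
have [g ag fg] := h _ e20; have [s hs] := ag _ e20.
exists s => x Dx; rewrite -(subrKA (g x)) (le_trans (ler_normD _ _)) //.
by rewrite [leRHS]splitr lerD // ?fg ?hs.
Qed.

Hypothesis bD : exists B : R, forall x, D x -> forall i, `|x ord0 i| <= B.

Lemma monom_bounded al : exists M : R, forall x, D x -> `|monom x al| <= M.
Proof.
have [B hB] := bD; exists (\prod_(i < n) B ^+ al i) => x Dx.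
rewrite /monom normr_prod; apply: ler_prod => i _.
by rewrite normr_ge0 normrX lerXn2r ?nnegrE ?(le_trans _ (hB x Dx i)) ?hB.
Qed.

Lemma lincomb_bounded s :
  exists2 M : R, 0 <= M & forall x, D x -> `|lincomb (monom x) s| <= M.
Proof.
elim: s => [|a s [M M0 hM]].
  by exists 0 => // x _; rewrite lincomb_nil normr0.
have [N hN] := monom_bounded a.2; exists (`|a.1| * `|N| + M).
  by rewrite addr_ge0 // mulr_ge0.
move=> x Dx; rewrite lincomb_cons (le_trans (ler_normD _ _)) // lerD ?hM //.
by rewrite normrM ler_wpM2l // (le_trans (hN x Dx)) // ler_norm.
Qed.

Lemma approximable_bounded f : approximable f ->
  exists2 M : R, 0 < M & forall x, D x -> `|f x| <= M.
Proof.
move=> af; have [s hs] := af _ ltr01; have [M M0 hM] := lincomb_bounded s.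
exists (1 + M) => [|x Dx]; first by rewrite ltr_pwDl.
rewrite -(subrK (lincomb (monom x) s) (f x)) (le_trans (ler_normD _ _)) //.
by rewrite lerD ?hs ?hM.
Qed.

Lemma approximableM f g : approximable f -> approximable g ->
  approximable (fun x => f x * g x).
Proof.
move=> af ag; have [M M0 hM] := approximable_bounded af.
apply: approximable_unif => e e0.
have eM : 0 < e / M by exact: divr_gt0.
have [t ht] := ag _ eM.
have [N N0 hN] := lincomb_bounded t.
have N1 : 0 < N + 1 by rewrite ltr_wpDl.
exists (fun x => f x * lincomb (monom x) t); last first.
  move=> x Dx; rewrite -mulrBr normrM.
  have -> : e = M * (e / M) by rewrite mulrCA divff ?mulr1 // lt0r_neq0.
  by rewrite ler_pM // ?hM ?ht.
move=> d d0; have [s hs] := af _ (divr_gt0 d0 N1).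
exists (lmul s t) => x Dx; rewrite lincomb_mul -mulrBl normrM.
have -> : d = d / (N + 1) * (N + 1) by rewrite divfK // lt0r_neq0.
by rewrite ler_pM ?hs // (le_trans (hN x Dx)) // lerDl.
Qed.

(* The iteration [r := r + (u ^+ 2 - r ^+ 2) / 2] increases to [`|u|] on
   [[-1, 1]], with error at most [2 / (k + 2)] after [k] steps. *)
Let r u := fix loop k : R :=
  if k is k'.+1 then loop k' + (u ^+ 2 - loop k' ^+ 2) / 2 else 0.

Let r_bound (u : R) k : 0 <= u <= 1 ->
  0 <= r u k <= u /\ u - r u k <= 2 / k.+2%:R.
Proof.
move=> /andP[u0 u1]; elim: k => [|k [/andP[rk0 rku] rk]].
  by rewrite /= lexx u0 subr0; split=> //; rewrite divff // pnatr_eq0.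
set d := u - r u k in rk *.
have -> : r u k.+1 = u - d * (1 - (u + r u k) / 2) by rewrite /d /=; field.
have d0 : 0 <= d by rewrite subr_ge0.
have d1 : d <= u by rewrite lerBlDr lerDl.
have h1 : 0 <= 1 - (u + r u k) / 2 by lra.
(* Since [u + r >= u - r = d], the new error is at most [d (1 - d / 2)], which increases in [d] on
   [[0, 1]]. At [d = 2 / (k + 2)] it equals [2 (k + 1) / (k + 2)^2], and this is at most
   [2 / (k + 3)] because [(k + 1)(k + 3) = (k + 2)^2 - 1]. *)
have h2 : d * (1 - (u + r u k) / 2) <= d * (1 - d / 2).
  by rewrite ler_wpM2l //; rewrite /d; lra.
have h3 : d * (1 - (u + r u k) / 2) <= d by rewrite ler_piMr //; lra.
have h4 : 0 <= d * (1 - (u + r u k) / 2) by rewrite mulr_ge0.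
split.
  move: h3 h4; move: (d * _) => w h3 h4.
  by rewrite subr_ge0 (le_trans h3 d1) /= gerBl.
rewrite opprB addrCA subrr addr0; apply: (le_trans h2).
have k2 : 0 < k.+2%:R :> R by rewrite ltr0n.
have k3 : 0 < k.+3%:R :> R by rewrite ltr0n.
set q := 2 / k.+2%:R in rk.
have q1 : q <= 1 by rewrite /q ler_pdivrMr // mul1r ler_nat.
apply: (@le_trans _ _ (q * (1 - q / 2))); first by nra.
rewrite /q ler_pdivlMr //.
have -> : k.+3%:R = k.+2%:R + 1 :> R by rewrite -natr1.
have -> : 2 / k.+2%:R * (1 - 2 / k.+2%:R / 2) * (k.+2%:R + 1) =
  2 * (k.+2%:R ^+ 2 - 1) / k.+2%:R ^+ 2 :> R by field; rewrite lt0r_neq0.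
rewrite ler_pdivrMr ?exprn_gt0 // ler_wpM2l //; lra.
Qed.

Lemma approximable_norm f : approximable f -> approximable (fun x => `|f x|).
Proof.
move=> af; have [M M0 hM] := approximable_bounded af.
pose g x := M^-1 * f x.
have ag : approximable g by exact: approximableZ.
suff agn : approximable (fun x => `|g x|).
  apply: approximable_ext (approximableZ M agn) => x Dx.
  by rewrite /g normrM gtr0_norm ?invr_gt0 // mulrA divff ?mul1r // lt0r_neq0.
apply: approximable_unif => e e0.
have [k hk] : exists k, 2 / k.+2%:R <= e.
  have h : 2 / e <= (Num.bound (2 / e))%:R.
    by apply/ltW/archi_boundP; rewrite divr_ge0 // ltW.
  exists (Num.bound (2 / e)); rewrite ler_pdivrMr ?ltr0n // mulrC -ler_pdivrMr //.
  by rewrite (le_trans h) // ler_nat; do 2 apply: leqW.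
(* [r] sees its argument only through its square, and the square of [|g x|] is that of [g x]; so
   every iterate stays approximable. *)
exists (fun x => r `|g x| k).
  elim: k {hk} => [|k IH] /=; first exact: approximable_cst.
  apply: (approximable_ext (f := fun x => r `|g x| k +
      2^-1 * (g x * g x - r `|g x| k * r `|g x| k))).
    by move=> x _; rewrite real_normK ?num_real // mulrC -!expr2.
  apply: approximableD => //; apply: approximableZ.
  by apply: approximableB; exact: approximableM.
move=> x Dx; have gx : 0 <= `|g x| <= 1.
  rewrite normr_ge0 /= /g normrM gtr0_norm ?invr_gt0 // mulrC ler_pdivrMr //.
  by rewrite mul1r hM.
have [/andP[_ h1] h2] := r_bound k gx.
by rewrite ger0_norm ?subr_ge0 // (le_trans h2).
Qed.

Lemma approximable_min f g : approximable f -> approximable g ->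
  approximable (fun x => Num.min (f x) (g x)).
Proof.
move=> af ag.
have h := approximableB (approximableD af ag)
  (approximable_norm (approximableB af ag)).
apply: approximable_ext (approximableZ 2^-1 h) => x _.
by rewrite minr_absE mulrC.
Qed.

Lemma approximable_max f g : approximable f -> approximable g ->
  approximable (fun x => Num.max (f x) (g x)).
Proof.
move=> af ag.
have h := approximableD (approximableD af ag)
  (approximable_norm (approximableB af ag)).
apply: approximable_ext (approximableZ 2^-1 h) => x _.
by rewrite maxr_absE mulrC.
Qed.

End UniformClosure.

(** * The value of a positive moment functional on uniform limits of polynomials *)

Section Extension.
Variables (R : realType) (n : nat) (D : set 'rV[R]_n) (m : mindex n -> R).

Definition moment_positive := forall s,
  (forall x, D x -> 0 <= lincomb (monom x) s) -> 0 <= lincomb m s.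

(** An infimum over polynomial majorants gives a total function without choosing approximating
    sequences; on approximable functions it is the extension by uniform continuity
    ([extend_close]). *)
Definition extend (f : 'rV[R]_n -> R) : R :=
  inf [set lincomb m s | s in
        [set s | forall x, D x -> f x <= lincomb (monom x) s]].

Hypothesis mpos : moment_positive.
Implicit Types f g : 'rV[R]_n -> R.

(** Used in both directions it shows that [lincomb m s] depends only on the values of [s] on [D], so
    it is harmless that a polynomial has many lists. *)
Lemma moment_mono s t :
  (forall x, D x -> lincomb (monom x) s <= lincomb (monom x) t) ->
  lincomb m s <= lincomb m t.
Proof.
move=> st; have := mpos (s := t ++ lscale (-1) s).
rewrite lincomb_cat lincomb_scale mulN1r subr_ge0; apply => x Dx.
by rewrite lincomb_cat lincomb_scale mulN1r subr_ge0 st.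
Qed.

Lemma moment0_ge0 : 0 <= m (@idx0 n).
Proof.
have := mpos (s := [:: (1, @idx0 n)]).
rewrite lincomb_cons lincomb_nil addr0 mul1r; apply => x _.
by rewrite lincomb_cons lincomb_nil addr0 mul1r monom0 ler01.
Qed.

(** The polynomials [s - e] and [s + e] enclose [f] on [D], and shifting by the constant [e] changes
    the functional by [e * m idx0]. *)
Lemma extend_close f s e :
  (forall x, D x -> `|f x - lincomb (monom x) s| <= e) ->
  `|extend f - lincomb m s| <= e * m (@idx0 n).
Proof.
move=> fs; pose E := [set lincomb m t | t in
  [set t | forall x, D x -> f x <= lincomb (monom x) t]].
have lE : lbound E (lincomb m s - e * m (@idx0 n)).
  move=> _ [t ht <-]; rewrite lerBlDr -[leRHS]addrC.
  have := @moment_mono s ((e, @idx0 n) :: t).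
  rewrite lincomb_cons; apply => x Dx; rewrite lincomb_cons /= monom0 mulr1.
  by have := fs x Dx; have := ht x Dx; rewrite ler_norml => ? /andP[? ?]; lra.
have hE : E (lincomb m ((e, @idx0 n) :: s)).
  exists ((e, @idx0 n) :: s) => // x Dx; rewrite lincomb_cons /= monom0 mulr1.
  by have := fs x Dx; rewrite ler_norml => /andP[? ?]; lra.
have h1 : extend f <= e * m (@idx0 n) + lincomb m s.
  rewrite -(lincomb_cons m (e, @idx0 n)); apply: ge_inf => //.
  by eexists; exact: lE.
have h2 : lincomb m s - e * m (@idx0 n) <= extend f.
  by apply: lb_le_inf => //; eexists; exact: hE.
rewrite ler_norml; apply/andP; split; lra.
Qed.

Lemma extend_poly s : extend (fun x => lincomb (monom x) s) = lincomb m s.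
Proof.
apply/eqP; rewrite -subr_eq0 -normr_le0 -(mul0r (m (@idx0 n))).
by apply: extend_close => x _; rewrite subrr normr0.
Qed.

Lemma extend_lin c f g : approximable D f -> approximable D g ->
  extend (fun x => c * f x + g x) = c * extend f + extend g.
Proof.
move=> af ag; apply/eqP; rewrite -subr_eq0; apply/eqP.
apply: (@le_all_eps_eq0 _ _ (2 * (`|c| + 1) * m (@idx0 n))) => e e0.
have [s hs] := af _ e0; have [t ht] := ag _ e0.
have h : `|extend (fun x => c * f x + g x) - lincomb m (lscale c s ++ t)|
    <= ((`|c| + 1) * e) * m (@idx0 n).
  apply: extend_close => x Dx; rewrite lincomb_cat lincomb_scale.
  have -> : c * f x + g x - (c * lincomb (monom x) s + lincomb (monom x) t) =
    c * (f x - lincomb (monom x) s) + (g x - lincomb (monom x) t) by ring.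
  apply: (le_trans (ler_normD _ _)); rewrite normrM mulrDl mul1r.
  by rewrite lerD ?ht // ler_wpM2l // hs.
have hf := extend_close hs; have hg := extend_close ht.
have -> : extend (fun x => c * f x + g x) - (c * extend f + extend g) =
  (extend (fun x => c * f x + g x) - lincomb m (lscale c s ++ t)) -
  (c * (extend f - lincomb m s) + (extend g - lincomb m t)).
  by rewrite lincomb_cat lincomb_scale; ring.
apply: (le_trans (ler_normB _ _)).
have h3 : `|c * (extend f - lincomb m s) + (extend g - lincomb m t)| <=
   `|c| * (e * m (@idx0 n)) + e * m (@idx0 n).
  by rewrite (le_trans (ler_normD _ _)) // lerD // normrM ler_wpM2l.
apply: (le_trans (lerD h h3)).
by rewrite le_eqVlt; apply/orP; left; apply/eqP; ring.
Qed.

Lemma extend_le f g : approximable D f -> approximable D g ->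
  (forall x, D x -> f x <= g x) -> extend f <= extend g.
Proof.
move=> af ag fg.
have [s hs] := ag _ ltr01.
apply: lb_le_inf.
  exists (lincomb m ((1, @idx0 n) :: s)), ((1, @idx0 n) :: s) => // x Dx.
  rewrite lincomb_cons /= monom0 mulr1.
  by have := hs x Dx; rewrite ler_norml => /andP[? ?]; lra.
have [u hu] := af _ ltr01.
move=> _ [t ht <-]; apply: ge_inf.
  exists (lincomb m u - m (@idx0 n)) => _ [t' ht' <-]; rewrite lerBlDr.
  have := @moment_mono u ((1, @idx0 n) :: t').
  rewrite lincomb_cons mul1r addrC; apply => x Dx.
  rewrite lincomb_cons /= monom0 mulr1; have := ht' x Dx.
  by have := hu x Dx; rewrite ler_norml => /andP[? ?]; lra.
by exists t => // x Dx; rewrite (le_trans (fg x Dx)) // ht.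
Qed.

End Extension.

(** * The outer measure of a positive moment functional *)

Section RieszOuterMeasure.
Variables (R : realType) (n : nat) (D : set 'rV[R]_n) (m : mindex n -> R).
Hypothesis cD : compact D.
Hypothesis mpos : moment_positive D m.
Implicit Types (S : set 'rV[R]_n) (c : R) (f g : 'rV[R]_n -> R).

Lemma compact_coord_bounded :
  exists B : R, forall x, D x -> forall i, `|x ord0 i| <= B.
Proof.
have [B [Breal hB]] := compact_bounded cD.
exists (B + 1) => x Dx i; have B1 : B < B + 1 by rewrite ltrDl.
apply: le_trans (hB _ B1 x Dx).
by rewrite /Num.norm/= mx_normrE (le_trans _ (le_bigmax _ _ (ord0, i))).
Qed.
Let bD := compact_coord_bounded.

Local Notation U := (extend D m).
Local Notation apx := (approximable D).

Lemma extendD f g : apx f -> apx g -> U (fun x => f x + g x) = U f + U g.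
Proof.
move=> af ag; rewrite -[U f]mul1r -extend_lin //; congr extend.
by apply/funext => x; rewrite mul1r.
Qed.

Lemma extend_cst c : U (fun=> c) = c * m (@idx0 n).
Proof.
have := extend_poly mpos [:: (c, @idx0 n)].
rewrite lincomb_cons lincomb_nil addr0 => <-; congr extend; apply/funext => x.
by rewrite lincomb_cons lincomb_nil addr0 /= monom0 mulr1.
Qed.

Lemma extendB f g : apx f -> apx g -> U (fun x => f x - g x) = U f - U g.
Proof.
move=> af ag; rewrite -[- U g]mulN1r addrC -extend_lin //; congr extend.
by apply/funext => x; rewrite mulN1r addrC.
Qed.

Lemma extendZ c f : apx f -> U (fun x => c * f x) = c * U f.
Proof.
move=> af; rewrite -[RHS]addr0 -[X in _ = _ + X](mul0r (m (@idx0 n))) -extend_cst.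
rewrite -extend_lin //; last exact: approximable_cst.
by congr extend; apply/funext => x; rewrite addr0.
Qed.

Lemma extend_sum (I : Type) (r : seq I) (F : I -> 'rV[R]_n -> R) :
  (forall i, apx (F i)) ->
  U (fun x => \sum_(i <- r) F i x) = \sum_(i <- r) U (F i).
Proof.
move=> aF; elim: r => [|i r IH].
  rewrite big_nil -[RHS](mul0r (m (@idx0 n))) -extend_cst; congr extend.
  by apply/funext => x; rewrite big_nil.
rewrite big_cons -IH -extendD //; last exact: approximable_sum.
by congr extend; apply/funext => x; rewrite big_cons.
Qed.

Lemma extend_ge0 f : apx f -> (forall x, D x -> 0 <= f x) -> 0 <= U f.
Proof.
move=> af f0; rewrite -[leLHS](mul0r (m (@idx0 n))) -extend_cst.
by apply: extend_le => //; exact: approximable_cst.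
Qed.

(** The sequence stands for its increasing limit, a function that is at least 1 on [S] within [D]
    and whose integral should be at most [c] by monotone convergence. Allowing sequences, not just
    single functions, is what yields countable subadditivity. Points outside [D] impose nothing, so
    the mass sits on [D]. *)
Definition cover_bound S c := exists f : nat -> 'rV[R]_n -> R,
  [/\ forall k, apx (f k), forall k x, D x -> 0 <= f k x,
      forall k x, D x -> f k x <= f k.+1 x, forall k, U (f k) <= c &
      forall x, S x -> D x -> exists k, 1 <= f k x].

Definition riesz_outer S : R := inf [set c | cover_bound S c].

Lemma cover_bound_ge0 S c : cover_bound S c -> 0 <= c.
Proof.
move=> [f [af f0 _ fc _]]; apply: le_trans (fc 0%N).
by apply: extend_ge0 => // x; exact: f0.
Qed.

Lemma cover_bound_cst S f : apx f -> (forall x, D x -> 0 <= f x) ->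
  (forall x, S x -> D x -> 1 <= f x) -> cover_bound S (U f).
Proof.
by move=> af f0 f1; exists (fun=> f); split=> // x Sx Dx; exists 0%N; exact: f1.
Qed.

Lemma cover_bound_total S : cover_bound S (m (@idx0 n)).
Proof.
rewrite -[m _]mul1r -extend_cst; apply: cover_bound_cst => //.
exact: approximable_cst.
Qed.

Lemma riesz_outer_le S c : cover_bound S c -> riesz_outer S <= c.
Proof.
by move=> Sc; apply: ge_inf => //; exists 0 => d /cover_bound_ge0.
Qed.

Lemma riesz_outer_ge S c : (forall d, cover_bound S d -> c <= d) ->
  c <= riesz_outer S.
Proof. by apply: lb_le_inf; exists (m (@idx0 n)); exact: cover_bound_total. Qed.

Lemma riesz_outer_near S e : 0 < e ->
  exists2 c, cover_bound S c & c <= riesz_outer S + e.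
Proof.
move=> e0; have [|c Sc /ltW ce] := @inf_adherent _ [set c | cover_bound S c] _ e0.
  split; last by exists 0 => d /cover_bound_ge0.
  by exists (m (@idx0 n)); exact: cover_bound_total.
by exists c.
Qed.

Lemma riesz_outer_ge0 S : 0 <= riesz_outer S.
Proof. by apply: riesz_outer_ge => c /cover_bound_ge0. Qed.

Lemma riesz_outer_mono S S' : S `<=` S' -> riesz_outer S <= riesz_outer S'.
Proof.
move=> SS'; apply: riesz_outer_ge => c [f [af f0 fi fc fS']].
by apply: riesz_outer_le; exists f; split=> // x /SS'; exact: fS'.
Qed.

Lemma riesz_outer0 : riesz_outer set0 = 0.
Proof.
apply/eqP; rewrite eq_le riesz_outer_ge0 andbT.
rewrite -[leRHS](mul0r (m (@idx0 n))) -extend_cst; apply: riesz_outer_le.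
by apply: cover_bound_cst => //; exact: approximable_cst.
Qed.

Lemma nondec_seq_le (f : nat -> 'rV[R]_n -> R) x :
  (forall k, f k x <= f k.+1 x) -> forall j k, (j <= k)%N -> f j x <= f k x.
Proof.
move=> fi j k; elim: k => [|k IH]; first by rewrite leqn0 => /eqP ->.
by rewrite leq_eqVlt => /predU1P[->//|/IH /le_trans]; apply.
Qed.

Lemma riesz_outer_sigma_subadditive :
  sigma_subadditive (fun S => (riesz_outer S)%:E).
Proof.
move=> F /=; set s := (\sum_(i <oo) _)%E.
have s0 : (0 <= s)%E by apply: nneseries_ge0 => i _ _; rewrite lee_fin riesz_outer_ge0.
case: (ltP s +oo%E) => [soo|]; last by rewrite leye_eq => /eqP ->; rewrite leey.
have sfin : s \is a fin_num by rewrite ge0_fin_numE.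
apply/lee_addgt0Pr => e e0; rewrite -(fineK sfin) -EFinD lee_fin.
apply: riesz_outer_le.
have hc i : exists cf : R * (nat -> 'rV[R]_n -> R),
    cf.1 <= riesz_outer (F i) + e / (2 ^ i.+1)%:R /\
    [/\ forall k, apx (cf.2 k), forall k x, D x -> 0 <= cf.2 k x,
      forall k x, D x -> cf.2 k x <= cf.2 k.+1 x, forall k, U (cf.2 k) <= cf.1 &
      forall x, F i x -> D x -> exists k, 1 <= cf.2 k x].
  have ei : 0 < e / (2 ^ i.+1)%:R by rewrite divr_gt0 // ltr0n expn_gt0.
  by have [c [f hf] ce] := riesz_outer_near (F i) ei; exists (c, f).
have {hc} [cf hcf] := choice hc.
pose f i := (cf i).2; pose c i := (cf i).1.
have hf i : [/\ forall k, apx (f i k), forall k x, D x -> 0 <= f i k x,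
      forall k x, D x -> f i k x <= f i k.+1 x, forall k, U (f i k) <= c i &
      forall x, F i x -> D x -> exists k, 1 <= f i k x] := (hcf i).2.
(* The covers are added along the diagonal: the [k]-th function takes the [k]-th member of the first
   [k] covers. It increases with [k] because members increase and each new summand is nonnegative; a
   point of [F i] is reached once [k] exceeds [i] and the index at which [f i] reaches 1 there. *)
exists (fun k x => \sum_(i <- iota 0 k) f i k x); split.
- by move=> k; apply: approximable_sum => i; case: (hf i).
- by move=> k x Dx; apply: sumr_ge0 => i _; case: (hf i) => _ + _ _ _; exact.
- move=> k x Dx; rewrite -[in leRHS]addn1 iotaD big_cat /= big_seq1 add0n.
  rewrite -[leLHS]addr0 lerD //; last by case: (hf k) => _ + _ _ _; exact.
  by rewrite addn1; apply: ler_sum => i _; case: (hf i) => _ _ + _ _; exact.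
- move=> k; rewrite extend_sum => [|i]; last by case: (hf i).
  rewrite -lee_fin EFinD fineK // -sumEFin.
  apply: le_trans (epsilon_trick _ _ (ltW e0)); last first.
    by move=> i; rewrite lee_fin riesz_outer_ge0.
  apply: le_trans (nneseries_lim_ge k _); last first.
    move=> i _; rewrite -EFinD lee_fin addr_ge0 ?riesz_outer_ge0 //.
    by rewrite divr_ge0 // ltW.
  rewrite /index_iota subn0; apply: lee_sum => i _; rewrite -EFinD lee_fin.
  by apply: le_trans (hcf i).1; case: (hf i).
- move=> x [i _ Fix] Dx; case: (hf i) => _ f0 fi _ /(_ _ Fix Dx)[k fk].
  exists (maxn k i.+1).
  have ii : i \in iota 0 (maxn k i.+1) by rewrite mem_iota /= add0n leq_max ltnSn orbT.
  rewrite (bigD1_seq i) ?iota_uniq //=.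
  have h1 : 1 <= f i (maxn k i.+1) x.
    apply: (le_trans fk); apply: (nondec_seq_le (f := f i)); last exact: leq_maxl.
    by move=> j; exact: fi.
  apply: (le_trans h1); rewrite lerDl; apply: sumr_ge0 => j _.
  by case: (hf j) => _ + _ _ _; exact.
Qed.

Definition riesz_measure_fun S : \bar R := (riesz_outer S)%:E.

Let riesz_measure_fun0 : riesz_measure_fun set0 = 0%E.
Proof. by rewrite /riesz_measure_fun riesz_outer0. Qed.

Let riesz_measure_fun_ge0 S : (0 <= riesz_measure_fun S)%E.
Proof. by rewrite lee_fin riesz_outer_ge0. Qed.

Let riesz_measure_fun_mono : {homo riesz_measure_fun : A B / A `<=` B >-> (A <= B)%E}.
Proof. by move=> A B AB; rewrite lee_fin riesz_outer_mono. Qed.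

Definition riesz_outer_measure : {outer_measure set 'rV[R]_n -> \bar R} :=
  HB.pack riesz_measure_fun (isOuterMeasure.Build R 'rV[R]_n riesz_measure_fun
    riesz_measure_fun0 riesz_measure_fun_ge0 riesz_measure_fun_mono
    riesz_outer_sigma_subadditive).

(* [h j = min 1 (j q^+)] increases to the indicator of [q > 0], so that a cover
   [f] of [X] splits into the cover [f k * h k] of [X] inside [q > 0] and the
   cover [f k * (1 - h j)] of the rest, where [j] is fixed and large. *)
Lemma caratheodory_superlevel q : apx q ->
  riesz_outer_measure.-caratheodory [set x | 0 < q x].
Proof.
move=> aq; apply: le_caratheodory_measurable => X /=.
rewrite /riesz_measure_fun -EFinD lee_fin; apply: riesz_outer_ge => c.
move=> [f [af f0 fi fc fX]].
pose h j x := Num.min 1 (j%:R * Num.max 0 (q x)) : R.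
have ah j : apx (h j).
  apply: approximable_min => //; first exact: approximable_cst.
  by apply: approximableZ; apply: approximable_max => //; exact: approximable_cst.
have h0 j x : 0 <= h j x by rewrite le_min ler01 mulr_ge0 // le_max lexx.
have h1 j x : h j x <= 1 by rewrite ge_min lexx.
have hi j k x : (j <= k)%N -> h j x <= h k x.
  move=> jk; rewrite le_min h1 /= ge_min; apply/orP; right.
  by rewrite ler_wpM2r ?ler_nat // le_max lexx.
pose w k x := f k x * h k x.
have aw k : apx (w k) by exact: approximableM.
have wc k : U (w k) <= c.
  apply: le_trans (fc k); apply: extend_le => // x Dx.
  by rewrite /w ler_piMr // f0.
have hs : has_sup (range (fun k => U (w k))).
  by split; [exists (U (w 0%N)), 0%N|exists c => _ [k _ <-]].
pose a := sup (range (fun k => U (w k))).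
have wa k : U (w k) <= a by apply: ub_le_sup; [case: hs|exists k].
apply/ler_addgt0Pr => e e0.
(* The budget [c] is split as [a] for the part in [q > 0] and [c - a + e] for the rest. With
   [U (w j) > a - e], and [f (k + j) * h j >= w j] thanks to the index shift, what remains of
   [f (k + j)] has value below [c - a + e]; where [q <= 0], [h j] vanishes and nothing of the cover
   is lost. *)
have [_ [j _ <-] hj] := sup_adherent e0 hs.
have hA : riesz_outer (X `&` [set x | 0 < q x]) <= a.
  apply: riesz_outer_le; exists w; split=> //.
  - by move=> k x Dx; rewrite /w mulr_ge0 // f0.
  - by move=> k x Dx; rewrite /w ler_pM // ?f0 ?fi // hi.
  - move=> x [Xx /= qx] Dx; have [k fk] := fX x Xx Dx.
    pose l := maxn k (Num.bound (q x)^-1); exists l.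
    have -> : w l x = f l x.
      rewrite /w /h min_l ?mulr1 // max_r ?(ltW qx) // -ler_pdivrMr // mul1r.
      apply: (@le_trans _ _ (Num.bound (q x)^-1)%:R).
        by apply/ltW/archi_boundP; rewrite invr_ge0 ltW.
      by rewrite ler_nat leq_maxr.
    apply: (le_trans fk); apply: nondec_seq_le; last exact: leq_maxl.
    by move=> i; exact: fi.
have hB : riesz_outer (X `&` ~` [set x | 0 < q x]) <= c - a + e.
  apply: riesz_outer_le; exists (fun k x => f (k + j)%N x - f (k + j)%N x * h j x).
  split.
  - by move=> k; apply: approximableB => //; exact: approximableM.
  - by move=> k x Dx; rewrite subr_ge0 ler_piMr // f0.
  - move=> k x Dx.
    have e1 (y : R) : y - y * h j x = y * (1 - h j x) by ring.
    by rewrite !e1 ler_wpM2r ?subr_ge0 // fi.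
  - move=> k; rewrite extendB //; last exact: approximableM.
    have h2 : U (w j) <= U (fun x => f (k + j)%N x * h j x).
      apply: extend_le => //; first exact: approximableM.
      move=> x Dx; rewrite ler_wpM2r //; apply: nondec_seq_le; last exact: leq_addl.
      by move=> i; exact: fi.
    have := fc (k + j)%N; move: h2 hj; rewrite -/a; lra.
  - move=> x [Xx /= /negP]; rewrite -leNgt => qx Dx; have [k fk] := fX x Xx Dx.
    exists k; have -> : h j x = 0 by rewrite /h max_l // mulr0 min_r.
    rewrite mulr0 subr0 (le_trans fk) //.
    by apply: nondec_seq_le; [move=> i; exact: fi|exact: leq_addr].
lra.
Qed.

End RieszOuterMeasure.

(** * Borel sets and the Riesz measure *)

Section BorelSets.
Variables (R : realType) (n : nat).

Lemma monom_continuous (al : mindex n) : continuous (fun x : 'rV[R]_n => monom x al).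
Proof.
move=> x; rewrite /monom.
have FF : Filter (nbhs x) := nbhs_filter x.
apply: (@cvg_big _ _ _ _ _ mul_continuous _ (nbhs x)) => i _.
apply: (@continuous_comp _ _ _ (fun y : 'rV[R]_n => y ord0 i)
  (fun t : R => t ^+ al i) x); [exact: coord_continuous|exact: exprn_continuous].
Qed.

Lemma lincomb_continuous s :
  continuous (fun x : 'rV[R]_n => lincomb (monom x) s).
Proof.
elim: s => [|a s IH] x.
  have -> : (fun y : 'rV[R]_n => lincomb (monom y) [::]) = fun=> 0.
    by apply/funext => y; rewrite lincomb_nil.
  exact: cst_continuous.
have -> : (fun y : 'rV[R]_n => lincomb (monom y) (a :: s)) =
    fun y => a.1 * monom y a.2 + lincomb (monom y) s.
  by apply/funext => y; rewrite lincomb_cons.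
apply: (@continuousD R R^o _ (fun y : 'rV[R]_n => a.1 * monom y a.2)
  (fun y => lincomb (monom y) s) x); last exact: IH.
apply: (@continuousM _ _ (fun=> a.1) (fun y : 'rV[R]_n => monom y a.2)).
  exact: cst_continuous.
exact: monom_continuous.
Qed.

Lemma measurable_borel_open (A : set 'rV[R]_n) : open A ->
  measurable (A : set (Borel R n)).
Proof. by move=> oA; exact: sub_sigma_algebra. Qed.

Lemma measurable_borel_compact (A : set 'rV[R]_n) : compact A ->
  measurable (A : set (Borel R n)).
Proof.
move=> cA; rewrite -[A]setCK; apply: measurableC; apply: measurable_borel_open.
by apply: closed_openC; apply: compact_closed => //; exact: norm_hausdorff.
Qed.

Lemma measurable_continuous (D : set (Borel R n)) (f : 'rV[R]_n -> R) :
  measurable D -> continuous f -> measurable_fun D (f : Borel R n -> R).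
Proof.
move=> mD cf; apply: measurable_funTS.
apply: (measurability _ (measurable_realfun.RGenOpens.measurableE R)).
move=> _ [_ [a [b ->]] <-]; rewrite setTI; apply: measurable_borel_open.
by apply: open_comp => [x _|]; [exact: cf|exact: interval_open].
Qed.

(* Boxes with corners in the grid [(N + 1)^-1 Z^n]. *)
Definition grid_box (p : nat * {ffun 'I_n -> int}) : set 'rV[R]_n :=
  [set x | forall i, `|x ord0 i - (p.2 i)%:~R / p.1.+1%:R| < p.1.+1%:R^-1].

(** The index type of the boxes is countable, so Borel measurability for the outer measure reduces
    to that of one box. *)
Lemma open_bigcup_boxes (A : set 'rV[R]_n) : open A ->
  A = \bigcup_p (if `[< grid_box p `<=` A >] then grid_box p else set0).
Proof.
move=> oA; apply/seteqP; split=> [x Ax|x [p _]]; last first.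
  by case: ifPn => // /asboolP h /h.
have /nbhs_ballP[e /= e0 he] : nbhs x A by exact: open_nbhs_nbhs.
(* Two points of one box differ by less than [2 / (N + 1)] in each coordinate. *)
pose N := Num.bound (2 / e).
have hN : 2 / N.+1%:R < e.
  rewrite ltr_pdivrMr ?ltr0n // mulrC -ltr_pdivrMr //.
  apply: (@lt_le_trans _ _ N%:R); last by rewrite ler_nat.
  by apply: archi_boundP; rewrite divr_ge0 // ltW.
have N0 : 0 < N.+1%:R :> R by rewrite ltr0n.
pose g : {ffun 'I_n -> int} := [ffun i => Num.floor (N.+1%:R * x ord0 i)].
have xg : grid_box (N, g) x.
  move=> i /=; rewrite ffunE.
  have /andP[h1 h2] := floor_itv (N.+1%:R * x ord0 i).
  move: h1 h2; rewrite intrD; move: (_%:~R) => z h1 h2.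
  have -> : x ord0 i - z / N.+1%:R = (N.+1%:R * x ord0 i - z) / N.+1%:R.
    by field; rewrite lt0r_neq0.
  rewrite normrM [X in _ * X]gtr0_norm ?invr_gt0 // -[ltRHS]mul1r.
  by rewrite ltr_pM2r ?invr_gt0 // ger0_norm; lra.
exists (N, g) => //; case: ifPn => // /negP; case; apply/asboolP => y yg.
apply: he; split=> // i j; rewrite !ord1 /ball /=.
have := xg j; have := yg j; rewrite /= => h1 h2.
have -> : x ord0 j - y ord0 j = (x ord0 j - (g j)%:~R / N.+1%:R) -
  (y ord0 j - (g j)%:~R / N.+1%:R) by ring.
apply: (le_lt_trans (ler_normB _ _)); apply: lt_trans hN.
by rewrite -[2]/(1 + 1) mulrDl mul1r ltrD.
Qed.

End BorelSets.

Section RieszMeasure.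
Variables (R : realType) (n : nat) (D : set 'rV[R]_n) (m : mindex n -> R).
Hypothesis cD : compact D.
Hypothesis mpos : moment_positive D m.

Let bD := compact_coord_bounded cD.
Local Notation U := (extend D m).
Local Notation mu := (riesz_outer_measure mpos).

(** A box is a finite intersection of sets [0 < q] with [q] a constant minus the absolute value of
    an affine function of one coordinate; such [q] are approximable because absolute values are. *)
Lemma open_caratheodory (A : set 'rV[R]_n) : open A -> mu.-caratheodory A.
Proof.
move=> oA; rewrite (open_bigcup_boxes oA).
change (mu.-cara.-measurable (\bigcup_p
  (if `[< grid_box p `<=` A >] then grid_box p else set0)
   : set (caratheodory_type mu))).
apply: countable_bigcupT_measurable => // p; case: ifPn => // _.
rewrite (_ : grid_box _ = \bigcap_(i in [set: 'I_n]) [set x : 'rV[R]_n |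
    0 < p.1.+1%:R^-1 - `|x ord0 i - (p.2 i)%:~R / p.1.+1%:R|]); last first.
  apply/seteqP; split=> x /= h i; first by move=> _; rewrite /= subr_gt0 h.
  by have := h i Logic.I; rewrite /= subr_gt0.
apply: fin_bigcap_measurable => // i _; apply: (caratheodory_superlevel cD mpos).
apply: approximableB; first exact: approximable_cst.
apply: approximable_norm => //; apply: approximableB; last exact: approximable_cst.
exact: approximable_coord.
Qed.

Lemma borel_caratheodory (A : set (Borel R n)) : measurable A ->
  mu.-cara.-measurable (A : set (caratheodory_type mu)).
Proof.
apply: smallest_sub; first exact: (sigma_algebra_measurable (caratheodory_type mu)).
exact: open_caratheodory.
Qed.

Let nu (A : set (Borel R n)) : \bar R := mu A.

Let nu0 : nu set0 = 0%E. Proof. exact: outer_measure0. Qed.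

Let nu_ge0 A : (0 <= nu A)%E. Proof. exact: outer_measure_ge0. Qed.

Let nu_sigma_additive : semi_sigma_additive nu.
Proof.
move=> F mF tF mUF; apply: (@caratheodory_measure_sigma_additive _ _ mu) => //.
- by move=> i; exact: borel_caratheodory.
- exact: borel_caratheodory.
Qed.

HB.instance Definition _ :=
  isMeasure.Build _ (Borel R n) R nu nu0 nu_ge0 nu_sigma_additive.

Let nu_fin : fin_num_fun nu.
Proof. by []. Qed.

HB.instance Definition _ := Measure_isFinite.Build _ (Borel R n) R nu nu_fin.

Definition riesz_measure : {finite_measure set (Borel R n) -> \bar R} := nu.

(* Dini: an increasing cover of the compact [D] is at least [1 - 3 e] on [D]
   from some index on. *)
Lemma riesz_outer_total : riesz_outer D m D = m (@idx0 n).
Proof.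
apply/eqP; rewrite eq_le (riesz_outer_le mpos) /=; last exact: cover_bound_total.
apply: riesz_outer_ge => // c [f [af f0 fi fc fD]].
have m0 := moment0_ge0 mpos.
apply/ler_addgt0Pl => e' e'0.
pose e := e' / (3 * (m (@idx0 n) + 1)).
have m1 : 0 < 3 * (m (@idx0 n) + 1) by lra.
have e0 : 0 < e by exact: divr_gt0.
have [s hs] := choice (fun k => af k _ e0).
(* [f k] is controlled only on [D], so the open sets are cut out by the polynomials [s k], which are
   within [e] of it there. Where [f k >= 1] the polynomial exceeds [1 - 2 e], and where it exceeds
   [1 - 2 e] one has [f k >= 1 - 3 e]. *)
have := cD; rewrite compact_cover => /(_ nat setT
  (fun k => [set x | 1 - 2 * e < lincomb (monom x) (s k)])) [].
- move=> k _; apply: (@open_comp _ _ (fun x => lincomb (monom x) (s k))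
    [set y | 1 - 2 * e < y]); last exact: open_gt.
  by move=> x _; exact: lincomb_continuous.
- move=> x Dx; have [k fk] := fD x Dx Dx; exists k => //=.
  have := hs k x Dx; rewrite ler_norml => /andP[_]; lra.
move=> E _ hE; pose K := \max_(k <- finmap.enum_fset E) k.
have hK x : D x -> 1 - 3 * e <= f K x.
  move=> Dx; have [k kE /= hk] := hE x Dx.
  have kK : (k <= K)%N by apply: leq_bigmax_seq.
  apply: (@le_trans _ _ (f k x)).
    have := hs k x Dx; rewrite ler_norml => /andP[]; lra.
  by apply: nondec_seq_le => // j; exact: fi.
have h : (1 - 3 * e) * m (@idx0 n) <= c.
  apply: le_trans (fc K); rewrite -(extend_cst mpos); apply: extend_le => //.
  exact: approximable_cst.
have -> : e' = 3 * e * (m (@idx0 n) + 1) by rewrite /e; field; lra.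
nra.
Qed.

End RieszMeasure.

(** * Integration on a compact set and uniqueness *)

Section IntegralsOnCompact.
Variables (R : realType) (n : nat) (D : set (Borel R n)).
Variable nu : {measure set (Borel R n) -> \bar R}.
Hypothesis cD : compact (D : set 'rV[R]_n).
Hypothesis nuD : (nu D < +oo)%E.

Let mD : measurable (D : set (Borel R n)) := measurable_borel_compact cD.
Let bD := compact_coord_bounded cD.

Lemma bounded_integrable (f : Borel R n -> R) (M : R) : measurable_fun D f ->
  (forall x, D x -> `|f x| <= M) -> nu.-integrable D (EFin \o f).
Proof.
move=> mf fM; apply: measurable_bounded_integrable => //.
exists M; split; first exact: num_real.
by move=> N MN x Dx; apply: le_trans (fM x Dx) (ltW MN).
Qed.

Lemma approximable_measurable (f : Borel R n -> R) :
  approximable D f -> measurable_fun D f.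
Proof.
move=> af; have e0 (k : nat) : 0 < k.+1%:R^-1 :> R by rewrite invr_gt0 ltr0n.
have [s hs] := choice (fun k => af _ (e0 k)).
apply: (@measurable_realfun.measurable_fun_cvg _ _ R D (fun k (x : Borel R n) => lincomb (monom x) (s k))).
  by move=> k; apply: measurable_continuous => //; exact: lincomb_continuous.
move=> x Dx; apply/cvgrPdist_le => e e00; near=> k.
apply: (le_trans (hs k x Dx)); apply: ltW; near: k.
exact: near_infty_natSinv_lt (PosNum e00).
Unshelve. all: by end_near. Qed.

Lemma approximable_integrable (f : Borel R n -> R) :
  approximable D f -> nu.-integrable D (EFin \o f).
Proof.
move=> af; have [M _ fM] := approximable_bounded bD af.
by apply: (bounded_integrable (M := M)) => //; exact: approximable_measurable.
Qed.

Lemma Rintegral_sum (I : Type) (r : seq I) (F : I -> Borel R n -> R) :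
  (forall i, nu.-integrable D (EFin \o F i)) ->
  nu.-integrable D (EFin \o (fun x => \sum_(i <- r) F i x)) /\
  \int[nu]_(x in D) (\sum_(i <- r) F i x) = \sum_(i <- r) \int[nu]_(x in D) F i x.
Proof.
move=> iF; elim: r => [|i r [IH1 IH2]].
  rewrite big_nil (_ : (fun x => _) = fun=> 0); last first.
    by apply/funext => x; rewrite big_nil.
  by split; [exact: integrable0|rewrite Rintegral_cst // mul0r].
rewrite big_cons -IH2 -RintegralD //.
have -> : (fun x => \sum_(j <- i :: r) F j x) =
    fun x => F i x + \sum_(j <- r) F j x.
  by apply/funext => x; rewrite big_cons.
by split=> //; exact: (integrableD mD (iF i) IH1).
Qed.

Lemma Rintegral_lincomb s :
  \int[nu]_(x in D) lincomb (monom x) s =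
  lincomb (fun al => \int[nu]_(x in D) monom x al) s.
Proof.
have am al : nu.-integrable D (EFin \o (fun x : Borel R n => monom x al)).
  apply: approximable_integrable.
  apply: approximable_ext (approximable_poly D [:: (1, al)]) => x _.
  by rewrite lincomb_cons lincomb_nil mul1r addr0.
elim: s => [|a s IH].
  rewrite lincomb_nil -[RHS](mul0r (fine (nu D))) -Rintegral_cst //.
  by apply: eq_Rintegral => x _; rewrite lincomb_nil.
rewrite lincomb_cons -IH -RintegralZl // -RintegralD //.
- by apply: eq_Rintegral => x _; rewrite lincomb_cons.
- exact: (integrableZl mD a.1 (am a.2)).
- by apply: approximable_integrable; exact: approximable_poly.
Qed.

Lemma moments_positive :
  moment_positive D (fun al => \int[nu]_(x in D) monom x al).
Proof. by move=> s hs; rewrite -Rintegral_lincomb; apply: Rintegral_ge0. Qed.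

Lemma moments_idx0 : \int[nu]_(x in D) monom x (@idx0 n) = fine (nu D).
Proof.
rewrite -[RHS]mul1r -Rintegral_cst //.
by apply: eq_Rintegral => x _; rewrite monom0.
Qed.

Lemma Rintegral_approximable (f : Borel R n -> R) : approximable D f ->
  \int[nu]_(x in D) f x = extend D (fun al => \int[nu]_(x in D) monom x al) f.
Proof.
move=> af; apply/eqP; rewrite -subr_eq0; apply/eqP.
apply: (@le_all_eps_eq0 _ _ (2 * fine (nu D))) => e e0.
have [s hs] := af _ e0.
have h := extend_close moments_positive hs; rewrite moments_idx0 in h.
have is_ : nu.-integrable D (EFin \o (fun x : Borel R n => lincomb (monom x) s)).
  by apply: approximable_integrable; exact: approximable_poly.
have if_ := approximable_integrable af.
have h2 : `|\int[nu]_(x in D) f x - \int[nu]_(x in D) lincomb (monom x) s| <=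
    e * fine (nu D).
  rewrite -RintegralB // -Rintegral_cst //.
  apply: le_trans (le_normr_Rintegral _ _) _ => //; first exact: (integrableB mD if_ is_).
  apply: le_Rintegral => //.
    by have := integrable_norm (integrableB mD if_ is_).
  by apply: approximable_integrable; exact: approximable_cst.
rewrite Rintegral_lincomb in h2.
move: h h2; move: (lincomb _ s) (extend _ _ _) (Rintegral _ _ _) => a b c h h2.
have -> : c - b = (c - a) - (b - a) by ring.
by rewrite (le_trans (ler_normB _ _)) // mulrCA mulr_natl mulr2n lerD.
Qed.

(** Markov's inequality along a cover [f]: the sets where [f k >= 1] increase to a superset of [S],
    and each has measure at most the integral of [f k], hence at most [c]. *)
Lemma le_riesz_outer (S : set (Borel R n)) : measurable S -> S `<=` D ->
  fine (nu S) <= riesz_outer D (fun al => \int[nu]_(x in D) monom x al) S.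
Proof.
move=> mS SD; apply: riesz_outer_ge; first exact: moments_positive.
move=> c [f [af f0 fi fc fS]].
pose A k : set (Borel R n) := D `&` f k @^-1` `[1, +oo[.
have inA k x : A k x <-> D x /\ 1 <= f k x by rewrite /A /= in_itv /= andbT.
have mA k : measurable (A k).
  by apply: approximable_measurable => //; exact: measurable_itv.
have Afin k : nu (A k) \is a fin_num.
  rewrite ge0_fin_numE //; apply: le_lt_trans nuD.
  by apply: le_measure; rewrite ?inE //; exact: subIsetl.
have nA : nondecreasing_seq A.
  move=> j k jk; apply/subsetPset => x /inA[Dx h]; apply/inA; split=> //.
  by apply: (le_trans h); apply: nondec_seq_le => // i; exact: fi.
have hA k : (nu (A k) <= c%:E)%E.
  rewrite -(fineK (Afin k)) lee_fin.
  have := fc k; rewrite -Rintegral_approximable //; apply: le_trans.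
  have -> : fine (nu (A k)) = \int[nu]_(x in D) \1_(A k) x.
    by rewrite /Rintegral integral_indic // setIidl //; exact: subIsetl.
  apply: le_Rintegral => //.
  - apply: (bounded_integrable (M := 1)); first exact: measurable_funTS.
    by move=> x _; rewrite indicE ger0_norm ?ler0n // lern1 leq_b1.
  - exact: approximable_integrable.
  - move=> x Dx; rewrite indicE; case: (boolP (_ \in _)) => [|_]; last exact: f0.
    by rewrite inE => /inA[].
have SA : S `<=` \bigcup_k A k.
  move=> x Sx; have [k fk] := fS x Sx (SD _ Sx).
  by exists k => //; apply/inA; split; [exact: SD|].
have mUA : measurable (\bigcup_k A k) by exact: bigcupT_measurable.
have Ufin : (nu (\bigcup_k A k) <= c%:E)%E.
  have h := @nondecreasing_cvg_mu _ _ _ nu _ mA mUA nA.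
  by rewrite -(cvg_lim _ h) //; apply: lime_le; [apply/cvg_ex; eexists; exact: h|
    near=> k; exact: hA].
have Sfin : nu S \is a fin_num.
  rewrite ge0_fin_numE //; apply: le_lt_trans nuD.
  by apply: le_measure; rewrite ?inE.
rewrite -lee_fin fineK // (le_trans _ Ufin) //.
by apply: le_measure; rewrite ?inE.
Unshelve. all: by end_near. Qed.

(* Both sides have the same value on [D], so the inequality [le_riesz_outer]
   for [S] and for [D `\` S] forces equality. *)
Lemma eq_riesz_outer (S : set (Borel R n)) : measurable S -> S `<=` D ->
  fine (nu S) = riesz_outer D (fun al => \int[nu]_(x in D) monom x al) S.
Proof.
move=> mS SD; apply/eqP; rewrite eq_le le_riesz_outer //=.
have mpos := moments_positive.
pose rho := riesz_measure cD mpos.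
have fin (la : {measure set (Borel R n) -> \bar R}) : (la D < +oo)%E ->
    forall B : set (Borel R n), measurable B -> B `<=` D -> la B \is a fin_num.
  move=> laD B mB BD; rewrite ge0_fin_numE //; apply: le_lt_trans laD.
  by apply: le_measure; rewrite ?inE.
have mDS : measurable (D `\` S : set (Borel R n)) by exact: measurableD.
have split (la : {measure set (Borel R n) -> \bar R}) : (la D < +oo)%E ->
    fine (la D) = fine (la S) + fine (la (D `\` S)).
  move=> laD; have hS := fin la laD _ mS SD.
  have hDS := fin la laD _ mDS (@subDsetl _ D S); rewrite -fineD //.
  rewrite -measureU ?setDUK //.
  by apply/seteqP; split=> // x [? []].
have h1 := split nu nuD.
have := split rho _; rewrite /= => /(_ (ltry _)) h2.
have h3 : fine (rho D) = fine (nu D) by rewrite /= riesz_outer_total // moments_idx0.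
have := le_riesz_outer mDS (@subDsetl _ _ _).
have -> : riesz_outer D (fun al => \int[nu]_(x in D) monom x al) S = fine (rho S) by [].
have -> : riesz_outer D (fun al => \int[nu]_(x in D) monom x al) (D `\` S) =
  fine (rho (D `\` S)) by [].
move: h1 h2 h3; rewrite /=; lra.
Qed.

End IntegralsOnCompact.

(** * The moment problem on a compact set *)

Lemma min_le_count (R : realType) (t : R) (K : nat) :
  Num.min t K%:R <= 1 + \sum_(i <- iota 0 K) (i.+1%:R <= t)%R%:R.
Proof.
(* The exact count for [K <= t] is carried along because the bound alone loses too much when the
   minimum changes from [K] to [t] or [K + 1]. *)
suff [] : Num.min t K%:R <= 1 + \sum_(i <- iota 0 K) (i.+1%:R <= t)%R%:R :> R /\
  (K%:R <= t -> \sum_(i <- iota 0 K) (i.+1%:R <= t)%R%:R = K%:R :> R) by [].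
elim: K => [|K [IH1 IH2]].
  by rewrite big_nil addr0; split=> //; rewrite ge_min ler01 orbT.
rewrite -[in iota 0 _]addn1 iotaD big_cat /= big_seq1 add0n.
case: (leP K.+1%:R t) => [Kt|tK] /=.
  have Kt' : K%:R <= t by rewrite (le_trans _ Kt) // ler_nat.
  by rewrite IH2 // -natr1; split=> //; lra.
rewrite addr0; split=> //.
case: (leP K%:R t) => [Kt|tK']; last by rewrite min_l // in IH1; exact: ltW.
by rewrite IH2 // -[1]/(1%:R) -natrD add1n ltW.
Qed.

Section Haviland.
Variables (R : realType) (n : nat) (D : set (Borel R n)).
Hypothesis cD : compact (D : set 'rV[R]_n).
Let mD : measurable (D : set (Borel R n)) := measurable_borel_compact cD.
Let bD := compact_coord_bounded cD.

Section Existence.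
Variable m : mindex n -> R.
Hypothesis mpos : moment_positive D m.
Let mu := riesz_measure cD mpos.
Let muD : (mu D < +oo)%E. Proof. exact: ltry. Qed.

(* Layer cake: [h] is the sum of the slices [min h (i+1) - min h i], and the
   [i]-th slice covers the set where [h >= i + 1]. *)
Lemma Rintegral_le_slack (h : Borel R n -> R) : approximable D h ->
  (forall x, D x -> 0 <= h x) ->
  \int[mu]_(x in D) h x <= m (@idx0 n) + extend D m h.
Proof.
move=> ah h0; have [M M0 hM] := approximable_bounded bD ah.
pose K := Num.bound M.
have hK x : D x -> h x <= K%:R.
  move=> Dx; apply: (le_trans (ler_norm _)); apply: (le_trans (hM x Dx)).
  by apply/ltW/archi_boundP/ltW.
pose g i x : R := Num.min (h x) i.+1%:R - Num.min (h x) i%:R.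
have ag i : approximable D (g i).
  by apply: approximableB; apply: approximable_min => //; exact: approximable_cst.
pose A i : set (Borel R n) := D `&` h @^-1` `[i.+1%:R, +oo[.
have inA i x : A i x <-> D x /\ i.+1%:R <= h x by rewrite /A /= in_itv /= andbT.
have mA i : measurable (A i).
  by apply: (approximable_measurable cD) => //; exact: measurable_itv.
have AD i : A i `<=` D by exact: subIsetl.
have i1 i : mu.-integrable D (EFin \o (\1_(A i) : Borel R n -> R)).
  apply: (bounded_integrable cD muD (M := 1)); first exact: measurable_funTS.
  by move=> x _; rewrite indicE ger0_norm ?ler0n // lern1 leq_b1.
have [isum esum] := Rintegral_sum cD (iota 0 K) i1.
have ic := approximable_integrable cD muD (approximable_cst D (1 : R)).
have h1 : \int[mu]_(x in D) h x <=
    \int[mu]_(x in D) (1 + \sum_(i <- iota 0 K) \1_(A i) x).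
  apply: le_Rintegral => //.
  - exact: (approximable_integrable cD muD ah).
  - exact: (integrableD mD ic isum).
  - move=> x Dx; have := min_le_count (h x) K; rewrite min_l ?hK // => /le_trans.
    apply; rewrite lerD2l; apply: ler_sum => i _; rewrite indicE.
    case: (leP _ (h x)) => [hi|_]; last exact: ler0n.
    by have -> : x \in A i by apply/mem_set/inA.
apply: (le_trans h1); rewrite RintegralD // Rintegral_cst // mul1r [fine _]/= riesz_outer_total // lerD2l esum.
have -> : extend D m h = extend D m (fun x => \sum_(i <- iota 0 K) g i x).
  have agK := approximable_sum (iota 0 K) ag.
  have E x : D x -> \sum_(i <- iota 0 K) g i x = h x.
    move=> Dx; have -> : iota 0 K = index_iota 0 K by rewrite /index_iota subn0.
    rewrite (telescope_sumr (fun i => Num.min (h x) i%:R)) //.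
    by rewrite min_l ?hK // min_r ?h0 // subr0.
  by apply/eqP; rewrite eq_le !(extend_le mpos) // => x Dx; rewrite E.
rewrite extend_sum //; apply: ler_sum => i _.
have -> : \int[mu]_(x in D) \1_(A i) x = riesz_outer D m (A i).
  by rewrite /Rintegral integral_indic // setIidl.
apply: (riesz_outer_le mpos); apply: cover_bound_cst => //.
- move=> x Dx; rewrite subr_ge0 le_min ge_min lexx /= ge_min.
  by rewrite ler_nat leqnSn orbT.
- move=> x /inA[_ hx] Dx; rewrite /g min_r // min_r; last first.
    by rewrite (le_trans _ hx) // ler_nat.
  by rewrite -natr1 addrAC subrr add0r.
Qed.

(** The slack [m idx0] does not scale with [h]: apply the previous bound to [(N + 1) h] and divide
    by [N + 1]. *)
Lemma Rintegral_le_extend (h : Borel R n -> R) : approximable D h ->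
  (forall x, D x -> 0 <= h x) -> \int[mu]_(x in D) h x <= extend D m h.
Proof.
move=> ah h0; apply/ler_addgt0Pr => e e0.
have m0 := moment0_ge0 mpos.
pose N := Num.bound (m (@idx0 n) / e).
have hN : m (@idx0 n) / e < N.+1%:R.
  apply: (@lt_le_trans _ _ N%:R); last by rewrite ler_nat.
  by apply: archi_boundP; rewrite divr_ge0 // ltW.
have N0 : 0 < N.+1%:R :> R by rewrite ltr0n.
have := @Rintegral_le_slack (fun x => N.+1%:R * h x) (approximableZ _ ah).
rewrite RintegralZl // ?extendZ //; last exact: (approximable_integrable cD muD ah).
move=> /(_ (fun x Dx => mulr_ge0 (ltW N0) (h0 x Dx))).
move=> h1; have m0N : m (@idx0 n) <= N.+1%:R * e.
  by move: hN; rewrite ltr_pdivrMr // => /ltW.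
by rewrite -(ler_pM2l N0) (le_trans h1) // mulrDr addrC lerD2l.
Qed.

(** The inequality for nonnegative functions is applied to [M + x^al] and to [M - x^al]. Constants
    have the same value on both sides since the total mass is [m idx0], so both inequalities for
    [x^al] follow. *)
Lemma riesz_measure_moment al : \int[mu]_(x in D) monom x al = m al.
Proof.
have am : approximable D (fun x : 'rV[R]_n => monom x al).
  apply: approximable_ext (approximable_poly D [:: (1, al)]) => x _.
  by rewrite lincomb_cons lincomb_nil mul1r addr0.
have [M M0 hM] := approximable_bounded bD am.
have um : extend D m (fun x => monom x al) = m al.
  have := extend_poly mpos [:: (1, al)].
  rewrite lincomb_cons lincomb_nil mul1r addr0 => <-; congr extend.
  by apply/funext => x; rewrite lincomb_cons lincomb_nil mul1r addr0.
have im := approximable_integrable cD muD am.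
have ac : approximable D (fun=> M) by exact: approximable_cst.
have ic := approximable_integrable cD muD ac.
have h1 : M * m (@idx0 n) + \int[mu]_(x in D) monom x al <=
    M * m (@idx0 n) + m al.
  have := @Rintegral_le_extend (fun x => M + monom x al) (approximableD ac am).
  rewrite RintegralD // Rintegral_cst // [fine _]/= riesz_outer_total //.
  rewrite extendD // extend_cst // um; apply => x Dx.
  by have := hM x Dx; rewrite ler_norml => /andP[]; lra.
have h2 : M * m (@idx0 n) - \int[mu]_(x in D) monom x al <=
    M * m (@idx0 n) - m al.
  have := @Rintegral_le_extend (fun x => M - monom x al) (approximableB ac am).
  rewrite RintegralB // Rintegral_cst // [fine _]/= riesz_outer_total //.
  rewrite extendB // extend_cst // um; apply => x Dx.
  by have := hM x Dx; rewrite ler_norml => /andP[]; lra.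
apply/eqP; rewrite eq_le; move: h1 h2; rewrite lerD2l => -> /=.
by rewrite lerD2l lerN2.
Qed.

End Existence.

Section FiniteMeasures.
Implicit Types mu nu : {finite_measure set (Borel R n) -> \bar R}.

Lemma fine_finite_measureD mu nu S : measurable S ->
  fine (measure_add mu nu S) = fine (mu S) + fine (nu S).
Proof. by move=> mS; rewrite measure_addE fineD // fin_num_measure. Qed.

Lemma integrable_monom mu al :
  mu.-integrable D (EFin \o (fun x : Borel R n => monom x al)).
Proof.
apply: (approximable_integrable cD); first by rewrite -ge0_fin_numE // fin_num_measure.
apply: approximable_ext (approximable_poly D [:: (1, al)]) => x _.
by rewrite lincomb_cons lincomb_nil mul1r addr0.
Qed.

End FiniteMeasures.

End Haviland.

(** * Hilbert spaces *)

(** Stated for semidefinite forms because it also serves for [qform], which may be degenerate. *)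
Lemma form_cauchy_schwarz (R : realType) (V : lmodType R) (b : V -> V -> R) :
  (forall a x y z, b (a *: x + y) z = a * b x z + b y z) ->
  (forall x y, b x y = b y x) -> (forall x, 0 <= b x x) ->
  forall x y, b x y ^+ 2 <= b x x * b y y.
Proof.
move=> bl bs b0 x y.
have h t : 0 <= t ^+ 2 * b x x + 2 * t * b x y + b y y.
  have := b0 (t *: x + y).
  by rewrite bl bs bl [b y (_ + _)]bs bl [b y x]bs; lra.
have [bx|bx] := eqVneq (b x x) 0; last first.
  have bx0 : 0 < b x x by rewrite lt_neqAle eq_sym bx b0.
  have := h (- b x y / b x x).
  have -> : (- b x y / b x x) ^+ 2 * b x x + 2 * (- b x y / b x x) * b x y + b y y =
    (b x x * b y y - b x y ^+ 2) / b x x by field.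
  by rewrite pmulr_lge0 ?invr_gt0 // subr_ge0.
rewrite bx mul0r; have [->|bxy] := eqVneq (b x y) 0; first by rewrite expr0n.
(* With [b x x = 0] the quadratic is affine in [t]; this [t] gives it the value -1. *)
have := h (- (b y y + 1) / (2 * b x y)); rewrite bx mulr0 add0r.
have -> : 2 * (- (b y y + 1) / (2 * b x y)) * b x y + b y y = -1 by field.
by rewrite ler0N1.
Qed.

Section HilbertSpace.
Variables (R : realType) (V : lmodType R) (ip : V -> V -> R).
Hypothesis rip : real_inner_product ip.

Lemma ip_lin a x y z : ip (a *: x + y) z = a * ip x z + ip y z.
Proof. by case: rip. Qed.
Lemma ip_sym x y : ip x y = ip y x. Proof. by case: rip. Qed.
Lemma ip_ge0 x : 0 <= ip x x. Proof. by case: rip. Qed.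
Lemma ip_eq0 x : ip x x = 0 -> x = 0. Proof. by case: rip => ? ? ?; exact. Qed.
Lemma ipDl x y z : ip (x + y) z = ip x z + ip y z.
Proof. by rewrite -[x in LHS]scale1r ip_lin mul1r. Qed.
Lemma ip0l z : ip 0 z = 0.
Proof. by apply: (@addrI _ (ip 0 z)); rewrite -ipDl !addr0. Qed.
Lemma ipZl a x z : ip (a *: x) z = a * ip x z.
Proof. by rewrite -[a *: x]addr0 ip_lin ip0l addr0. Qed.
Lemma ipNl x z : ip (- x) z = - ip x z.
Proof. by rewrite -scaleN1r ipZl mulN1r. Qed.
Lemma ipBl x y z : ip (x - y) z = ip x z - ip y z.
Proof. by rewrite ipDl ipNl. Qed.
Lemma ipDr x y z : ip x (y + z) = ip x y + ip x z.
Proof. by rewrite ip_sym ipDl !(ip_sym x). Qed.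
Lemma ipZr a x z : ip x (a *: z) = a * ip x z.
Proof. by rewrite ip_sym ipZl (ip_sym x). Qed.
Lemma ipNr x z : ip x (- z) = - ip x z.
Proof. by rewrite ip_sym ipNl ip_sym. Qed.
Lemma ip0r z : ip z 0 = 0. Proof. by rewrite ip_sym ip0l. Qed.

Lemma ip_inj x y : (forall v, ip x v = ip y v) -> x = y.
Proof.
move=> h; apply/eqP; rewrite -subr_eq0; apply/eqP/ip_eq0.
by rewrite ipBl h subrr.
Qed.

Lemma ip_suml (I : Type) (r : seq I) (P : pred I) (F : I -> V) z :
  ip (\sum_(i <- r | P i) F i) z = \sum_(i <- r | P i) ip (F i) z.
Proof. by elim/big_rec2: _ => [|i y1 y2 _ <-]; rewrite ?ip0l // ipDl. Qed.

Lemma hnorm_ge0 x : 0 <= hnorm ip x. Proof. exact: sqrtr_ge0. Qed.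

Lemma sqr_hnorm x : hnorm ip x ^+ 2 = ip x x.
Proof. by rewrite sqr_sqrtr // ip_ge0. Qed.

Lemma cauchy_schwarz x y : `|ip x y| <= hnorm ip x * hnorm ip y.
Proof.
rewrite -(@ler_pXn2r _ 2) ?nnegrE ?mulr_ge0 ?hnorm_ge0 //.
rewrite exprMn !sqr_hnorm real_normK ?num_real //.
by apply: form_cauchy_schwarz; [exact: ip_lin|exact: ip_sym|exact: ip_ge0].
Qed.

Hypothesis cV : complete_space ip.

(* Minimise [ip v v - 2 f v]: minimising sequences are Cauchy by the
   parallelogram identity, and their limit represents [f]. *)
Lemma riesz_representation (f : V -> R) (C : R) :
  (forall a x y, f (a *: x + y) = a * f x + f y) ->
  (forall x, `|f x| <= C * hnorm ip x) ->
  exists w, forall v, ip w v = f v.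
Proof.
move=> fl fC.
have f0 : f 0 = 0.
  by have := fl 1 0 0; rewrite scale1r addr0 mul1r; lra.
have fD x y : f (x + y) = f x + f y by rewrite -[x in LHS]scale1r fl mul1r.
have fZ a x : f (a *: x) = a * f x by rewrite -[a *: x]addr0 fl f0 addr0.
pose E v := ip v v - 2 * f v.
have Elb v : - C ^+ 2 <= E v.
  have := fC v; rewrite ler_norml => /andP[_ h]; rewrite /E -sqr_hnorm.
  by have := sqr_ge0 (hnorm ip v - C); nra.
have hE : has_inf (range E).
  by split; [exists (E 0), 0|exists (- C ^+ 2) => _ [v _ <-]].
pose d := inf (range E).
have Ed v : d <= E v by apply: ge_inf; [case: hE|exists v].
have [u hu] : exists u : nat -> V, forall k, E (u k) < d + k.+1%:R^-1.
  have h k : exists v, E v < d + k.+1%:R^-1.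
    have k0 : 0 < k.+1%:R^-1 :> R by rewrite invr_gt0 ltr0n.
    by have [_ [v _ <-] hv] := inf_adherent k0 hE; exists v.
  by have [u hu] := choice h; exists u.
clearbody d; have small (e : R) : 0 < e -> exists N, forall m, (N <= m)%N -> m.+1%:R^-1 < e.
  move=> e0; have [N _ hN] := near_infty_natSinv_lt (PosNum e0).
  by exists N => m /hN.
have [|w hw] := @cV u.
  (* The squared norm of [u m - u k] is [2 (E (u m) + E (u k) - 2 E mid)], with [mid] the midpoint,
     hence below [2 (1 / (m + 1) + 1 / (k + 1))]. *)
  move=> e e0; have e2 : 0 < e ^+ 2 / 4 by rewrite divr_gt0 // exprn_gt0.
  have [N hN] := small _ e2; exists N => m k /hN hm /hN hk.
  rewrite -(@ltr_pXn2r _ 2) ?nnegrE ?hnorm_ge0 ?(ltW e0) // sqr_hnorm.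
  have := hu m; have := hu k; have := Ed (2^-1 *: (u m + u k)).
  rewrite /E !(ipNl, ipNr, ipZl, ipZr, ipDl, ipDr) fZ fD [ip (u k) (u m)]ip_sym.
  by move: hm hk; move: (m.+1%:R^-1) (k.+1%:R^-1) => a b; lra.
exists w => v; apply/eqP; rewrite -subr_eq0 -sqrf_eq0; apply/eqP.
(* The difference is [a - b] with [a = ip (u k) v - f v] and [b = ip (u k - w) v]. Both squares are
   at most [e * ip v v], and [(a - b)^2 <= 2 a^2 + 2 b^2]. *)
apply: (@le_all_eps_eq0 _ _ (4 * ip v v)) => e e0.
have [N1 h1] := small _ e0.
have se0 : 0 < Num.sqrt e by rewrite sqrtr_gt0.
have [N2 h2] := hw _ se0.
pose k := maxn N1 N2; have hk1 := h1 k (leq_maxl _ _).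
have hk2 : ip (u k - w) (u k - w) < e.
  rewrite -sqr_hnorm -[ltRHS](sqr_sqrtr (ltW e0)).
  rewrite ltr_pXn2r ?nnegrE ?hnorm_ge0 ?(ltW se0) //.
  exact: h2 (leq_maxr _ _).
have hk3 : (ip (u k) v - f v) ^+ 2 <= e * ip v v.
  have [v0|v0] := eqVneq (ip v v) 0.
    by rewrite (ip_eq0 v0) !ip0r f0 subrr expr0n /= mulr0.
  have vpos : 0 < ip v v by rewrite lt_neqAle eq_sym v0 ip_ge0.
  (* [u k] nearly minimises [E], so moving it by [t v] cannot lower [E] by more than [e]; the best
     [t] is then inserted. *)
  have key t : - t * (t * ip v v + 2 * (ip (u k) v - f v)) <= e.
    have := Ed (t *: v + u k); have := hu k; rewrite /E fl ip_lin.
    rewrite !ipDr !ipZr [ip v (u k)]ip_sym; move: hk1.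
    by move: (k.+1%:R^-1) => b; lra.
  move: key; set a := ip (u k) v - f v => /(_ (- a / ip v v)).
  have -> : - (- a / ip v v) * ((- a / ip v v) * ip v v + 2 * a) = a ^+ 2 / ip v v.
    by field.
  by rewrite ler_pdivrMr.
have hk4 : (ip (u k - w) v) ^+ 2 <= e * ip v v.
  apply: (@le_trans _ _ (ip (u k - w) (u k - w) * ip v v)).
    by apply: form_cauchy_schwarz; [exact: ip_lin|exact: ip_sym|exact: ip_ge0].
  by rewrite ler_wpM2r ?ip_ge0 // ltW.
rewrite ger0_norm ?sqr_ge0 //.
have -> : ip w v - f v = (ip (u k) v - f v) - ip (u k - w) v by rewrite ipBl; ring.
move: hk3 hk4; move: (ip (u k) v - f v) (ip (u k - w) v) => a b h3 h4.
have := sqr_ge0 (a + b); nra.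
Qed.

Variable J : option (V -> V).
Hypothesis hJ : if J is Some j then complex_structure ip j else True.

Lemma Bh_zero : Bh ip J (@zeroop R V).
Proof.
split; rewrite /zeroop.
- by move=> *; rewrite scaler0 addr0.
- by exists 0 => x; rewrite mul0r /hnorm ip0l sqrtr0.
- by move=> *; rewrite ip0l ip0r.
- case: J hJ => // j [jl _ _] x; have := jl 1 0 0; rewrite !scale1r addr0 => h.
  by apply: (@addrI _ (j 0)); rewrite addr0.
Qed.

Lemma hnorm_triangle x y : hnorm ip (x + y) <= hnorm ip x + hnorm ip y.
Proof.
rewrite -(@ler_pXn2r _ 2) ?nnegrE ?addr_ge0 ?hnorm_ge0 //.
rewrite sqrrD !sqr_hnorm ipDl !ipDr [ip y x]ip_sym.
by have := cauchy_schwarz x y; rewrite ler_norml => /andP[_]; lra.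
Qed.

Lemma hnormZ a x : hnorm ip (a *: x) = `|a| * hnorm ip x.
Proof. by rewrite /hnorm ipZl ipZr mulrA -expr2 sqrtrM ?sqr_ge0 // sqrtr_sqr. Qed.

Lemma Bh_lin c A B : Bh ip J A -> Bh ip J B -> Bh ip J (fun v => c *: A v + B v).
Proof.
move=> [Al [CA hA] As Aj] [Bl [CB hB] Bs Bj]; split.
- move=> a x y; rewrite Al Bl !scalerDr !scalerA [c * a]mulrC.
  by rewrite -!addrA; congr (_ + _); rewrite addrCA.
- exists (`|c| * CA + CB) => x; rewrite (le_trans (hnorm_triangle _ _)) //.
  by rewrite hnormZ mulrDl lerD // -mulrA ler_wpM2l.
- by move=> x y; rewrite ip_lin ipDr ipZr As Bs.
- case: J hJ Aj Bj => // j [jl _ _] Aj Bj x; rewrite Aj Bj.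
  by rewrite jl.
Qed.

Lemma Bh_id : Bh ip J (fun v => v).
Proof.
by split=> //; [exists 1 => x; rewrite mul1r|case: J].
Qed.

(** Makes every self-adjoint operator a difference of two positive ones, [c id + A] and [c id]. *)
Lemma psd_shift A : Bh ip J A ->
  exists2 c, 0 <= c & psd ip (fun v => c *: v + A v).
Proof.
move=> [_ [C hC] _ _]; exists `|C| => // v; rewrite ip_lin.
have h := cauchy_schwarz (A v) v.
have h2 : hnorm ip (A v) * hnorm ip v <= `|C| * ip v v.
  rewrite -sqr_hnorm expr2 mulrA ler_wpM2r ?hnorm_ge0 // (le_trans (hC v)) //.
  by rewrite ler_wpM2r ?hnorm_ge0 // ler_norm.
have := le_trans h h2; rewrite ler_norml => /andP[? _]; lra.
Qed.

(** As [j] is isometric with square -1, its adjoint is [- j]; the condition on [b] thus says that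
    the representing operator commutes with [j]. *)
Lemma operator_of_form (b : V -> V -> R) (C : R) :
  (forall a x y z, b (a *: x + y) z = a * b x z + b y z) ->
  (forall x y, b x y = b y x) ->
  (forall x y, `|b x y| <= C * (hnorm ip x * hnorm ip y)) ->
  (if J is Some j then forall x y, b (j x) y = - b x (j y) else True) ->
  exists2 B, Bh ip J B & forall u v, ip (B u) v = b u v.
Proof.
move=> bl bs bC bJ.
have hw u : exists w, forall v, ip w v = b u v.
  apply: (@riesz_representation (b u) (C * hnorm ip u)).
    by move=> a x y; rewrite !(bs u) bl.
  by move=> x; rewrite -mulrA.
have [B hB] := choice hw; exists B => //; split.
- move=> a x y; apply: ip_inj => v.
  by rewrite hB bl ip_lin !hB.
- exists `|C| => x.
  have [x0|x0] := eqVneq (hnorm ip (B x)) 0.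
    by rewrite x0 mulr_ge0 // hnorm_ge0.
  have xpos : 0 < hnorm ip (B x) by rewrite lt_neqAle eq_sym x0 hnorm_ge0.
  rewrite -(ler_pM2r xpos) -expr2 sqr_hnorm hB (le_trans (ler_norm _)) //.
  rewrite (le_trans (bC _ _)) // mulrA ler_wpM2r ?hnorm_ge0 //.
  by rewrite ler_wpM2r ?hnorm_ge0 // ler_norm.
- by move=> x y; rewrite hB bs -hB ip_sym.
- case: J hJ bJ => // j [jl jj jip] bJ x; apply: ip_inj => v.
  by rewrite hB bJ -hB -(jip (B x)) jj ipNr opprK.
Qed.

End HilbertSpace.

(** * Multi-index shifts *)

Section MultiIndexSums.
Variables (n : nat) (V : zmodType).

Lemma mon_of_inj d : injective (@mon_of n d).
Proof.
move=> a b /ffunP ab; apply/ffunP => i; apply: val_inj.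
by have := ab i; rewrite !ffunE.
Qed.

Lemma mon_of_surj d (al : mindex n) : (forall i, (al i < d)%N) ->
  exists a : {ffun 'I_n -> 'I_d}, mon_of a = al.
Proof.
move=> h; exists [ffun i => Ordinal (h i)]; apply/ffunP => i.
by rewrite !ffunE.
Qed.

Lemma sum_mon_of_widen d d' (F : mindex n -> V) : (d <= d')%N ->
  (forall al : mindex n, (exists i, (d <= al i)%N) -> F al = 0) ->
  \sum_(a : {ffun 'I_n -> 'I_d'}) F (mon_of a) =
  \sum_(a : {ffun 'I_n -> 'I_d}) F (mon_of a).
Proof.
move=> dd' F0; pose h (a : {ffun 'I_n -> 'I_d}) : {ffun 'I_n -> 'I_d'} :=
  [ffun i => widen_ord dd' (a i)].
have hE a : mon_of (h a) = mon_of a by apply/ffunP => i; rewrite !ffunE.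
have hI : injective h.
  by move=> a b ab; apply: (@mon_of_inj d); rewrite -!hE ab.
pose T := {ffun 'I_n -> 'I_d}.
rewrite (bigID (fun b => b \in imset h (mem (predT : pred T)))) /=.
rewrite [X in _ + X]big1 ?addr0.
  rewrite big_imset /=; last by move=> a b _ _; exact: hI.
  by apply: eq_bigr => a _; rewrite hE.
move=> b bh; apply: F0; apply/not_existsP => H.
have H' i : (mon_of b i < d)%N by rewrite ltnNge; apply/negP; exact: H.
have [a ab] := mon_of_surj H'; move/negP: bh; apply.
by apply/imsetP; exists a => //; apply: (@mon_of_inj d'); rewrite hE.
Qed.

(** [opeval] sums over a box whose side is picked by choice; this replaces it by any valid degree
    bound. *)
Lemma sum_mon_of_indep d d' (F : mindex n -> V) :
  (forall al : mindex n, (exists i, (d <= al i)%N) -> F al = 0) ->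
  (forall al : mindex n, (exists i, (d' <= al i)%N) -> F al = 0) ->
  \sum_(a : {ffun 'I_n -> 'I_d}) F (mon_of a) =
  \sum_(a : {ffun 'I_n -> 'I_d'}) F (mon_of a).
Proof.
move=> Fd Fd'; rewrite -(sum_mon_of_widen (leq_maxl d d') Fd).
exact: (sum_mon_of_widen (leq_maxr d d') Fd').
Qed.

Lemma sum_mon_of_pick d (al : mindex n) (F : mindex n -> V) :
  (forall i, (al i < d)%N) -> (forall be, be != al -> F be = 0) ->
  \sum_(a : {ffun 'I_n -> 'I_d}) F (mon_of a) = F al.
Proof.
move=> h F0; have [a aE] := mon_of_surj h.
rewrite (bigD1 a) //= aE big1 ?addr0 // => b ba; apply: F0.
by apply: contra_neq ba => bal; apply: (@mon_of_inj d); rewrite bal.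
Qed.

End MultiIndexSums.

Section Shift.
Variables (R : realType) (n : nat).
Implicit Types (z w x : 'rV[R]_n) (be al : mindex n) (phi : mindex n -> R).

(** The coefficient of [x^al] in [(x + z)^be]. The binomial vanishes where the subtraction would
    truncate. *)
Definition shift_coef z be al : R :=
  \prod_(i < n) (z ord0 i ^+ (be i - al i) *+ 'C(be i, al i)).

Definition idx_max be : nat := \max_(i < n) be i.

Lemma leq_idx_max be i : (be i <= idx_max be)%N.
Proof. exact: leq_bigmax. Qed.

Lemma shift_coef0 z be al : (exists i, (be i < al i)%N) -> shift_coef z be al = 0.
Proof.
by move=> [i h]; rewrite /shift_coef (bigD1 i) //= bin_small // mulr0n mul0r.
Qed.

(* The list of the polynomial [(x + z)^be]. *)
Definition shift_list z be : seq (R * mindex n) :=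
  [seq (shift_coef z be (mon_of a), mon_of a) |
     a <- index_enum {ffun 'I_n -> 'I_(idx_max be).+1}].

Lemma lincomb_shift phi z be N : (forall i, (be i < N)%N) ->
  lincomb phi (shift_list z be) =
  \sum_(a : {ffun 'I_n -> 'I_N}) shift_coef z be (mon_of a) * phi (mon_of a).
Proof.
move=> hN; rewrite /lincomb big_map /=.
apply: (sum_mon_of_indep (F := fun al => shift_coef z be al * phi al)) => al [i hi].
  rewrite shift_coef0 ?mul0r //; exists i; apply: leq_trans hi.
  by rewrite ltnS leq_idx_max.
by rewrite shift_coef0 ?mul0r //; exists i; exact: leq_trans hi.
Qed.

Lemma lincomb_shift_monom x z be :
  lincomb (monom x) (shift_list z be) = monom (x + z) be.
Proof.
have hN i : (be i < (idx_max be).+1)%N by rewrite ltnS leq_idx_max.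
rewrite (lincomb_shift _ _ hN) /monom.
pose F i (j : 'I_(idx_max be).+1) : R :=
  z ord0 i ^+ (be i - j) *+ 'C(be i, j) * x ord0 i ^+ j.
transitivity (\sum_(a : {ffun 'I_n -> 'I_(idx_max be).+1}) \prod_(i < n) F i (a i)).
  apply: eq_bigr => a _; rewrite /shift_coef -big_split /=.
  by apply: eq_bigr => i _; rewrite !ffunE.
rewrite -bigA_distr_bigA /=; apply: eq_bigr => i _; rewrite mxE addrC exprDn.
rewrite (big_ord_widen _ (fun j => (z ord0 i ^+ (be i - j) * x ord0 i ^+ j)
  *+ 'C(be i, j)) (hN i)).
rewrite [RHS]big_mkcond /=; apply: eq_bigr => j _; rewrite /F.
case: ltnP => h; first by rewrite mulrnAl.
by rewrite bin_small // mulr0n mul0r.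
Qed.

Lemma coef_XaddC_exp (c : R) j g : (('X + c%:P) ^+ j)`_g = c ^+ (j - g) *+ 'C(j, g).
Proof.
rewrite addrC exprDn coef_sum.
under eq_bigr do rewrite coefMn -polyC_exp coefCM coefXn.
have [gj|jg] := ltnP g j.+1; last first.
  rewrite bin_small // mulr0n big1 // => i _; rewrite (_ : g == i = false).
    by rewrite mulr0 mul0rn.
  by apply/negbTE; rewrite neq_ltn (leq_trans (ltn_ord i)) ?orbT.
rewrite (bigD1 (Ordinal gj)) //= eqxx mulr1 big1 ?addr0 // => i ig.
rewrite (_ : g == i = false) ?mulr0 ?mul0rn //.
by apply: contraNF ig => /eqP gi; apply/eqP/val_inj; rewrite /= gi.
Qed.

(** Compare the coefficients of [X^g] in [((X - a) + a)^b = X^b]. *)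
Lemma shift_inv_1d (a : R) b g N : (b < N)%N ->
  \sum_(j < N) (a ^+ (b - j) *+ 'C(b, j)) * ((- a) ^+ (j - g) *+ 'C(j, g)) =
  (b == g)%:R.
Proof.
move=> bN; have : ('X + (- a)%:P + a%:P) ^+ b = 'X^b :> {poly R}.
  by rewrite polyCN addrNK.
rewrite addrC exprDn => /(congr1 (fun p : {poly R} => p`_g)).
rewrite coefXn eq_sym => <-; rewrite coef_sum.
rewrite (big_ord_widen _ (fun i => ((a%:P ^+ (b - i) * ('X + (- a)%:P) ^+ i)
  *+ 'C(b, i))`_g) bN) [RHS]big_mkcond /=; apply: eq_bigr => j _.
case: ltnP => h; last by rewrite bin_small // mulr0n mul0r.
by rewrite coefMn -polyC_exp coefCM coef_XaddC_exp mulrnAl.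
Qed.

(** [phi] is an arbitrary moment sequence, not an evaluation at a point, so the two translations
    have to cancel on coefficients. The sum over multi-indices factors into one-variable sums. *)
Lemma shift_inv phi z be :
  lincomb (fun ga => lincomb phi (shift_list (- z) ga)) (shift_list z be) = phi be.
Proof.
have hN i : (be i < (idx_max be).+1)%N by rewrite ltnS leq_idx_max.
rewrite (lincomb_shift _ _ hN); set N := (idx_max be).+1 in hN *.
transitivity (\sum_(a : {ffun 'I_n -> 'I_N}) \sum_(b : {ffun 'I_n -> 'I_N})
    shift_coef z be (mon_of a) * shift_coef (- z) (mon_of a) (mon_of b) *
    phi (mon_of b)).
  apply: eq_bigr => a _; rewrite (@lincomb_shift _ _ _ N) => [|i].
    by rewrite mulr_sumr; apply: eq_bigr => b _; rewrite mulrA.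
  by rewrite ffunE.
rewrite exchange_big /=.
transitivity (\sum_(b : {ffun 'I_n -> 'I_N})
    (\prod_(i < n) (be i == mon_of b i)%:R) * phi (mon_of b)).
  apply: eq_bigr => b _; rewrite -mulr_suml; congr (_ * _).
  pose F i (j : 'I_N) : R := (z ord0 i ^+ (be i - j) *+ 'C(be i, j)) *
    ((- z ord0 i) ^+ (j - mon_of b i) *+ 'C(j, mon_of b i)).
  transitivity (\sum_(a : {ffun 'I_n -> 'I_N}) \prod_(i < n) F i (a i)).
    apply: eq_bigr => a _; rewrite /shift_coef -big_split /=.
    by apply: eq_bigr => i _; rewrite /F !ffunE mxE.
  rewrite -bigA_distr_bigA /=; apply: eq_bigr => i _.
  by rewrite shift_inv_1d.
rewrite (sum_mon_of_pick (al := be)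
  (F := fun al => (\prod_(i < n) (be i == al i)%:R) * phi al)) //.
  by rewrite big1 ?mul1r // => i _; rewrite eqxx.
move=> al albe; have [i hi] : exists i, be i != al i.
  apply/existsP; rewrite -negb_forall; apply: contra albe => /forallP h.
  by apply/eqP/ffunP => i; apply/eqP; rewrite eq_sym.
by rewrite (bigD1 i) //= (negbTE hi) !mul0r.
Qed.

(** The signs of [Qcan] are absorbed into the powers of [- y], which exhibits its sum as the
    functional applied to [(x - y)^be]. *)
Lemma lincomb_shift_qcan phi y be :
  lincomb phi (shift_list (- y) be) =
  \sum_(a : {ffun 'I_n -> 'I_(idx_max be).+1} | [forall i, (mon_of a i <= be i)%N])
    ((\prod_(i < n) 'C(be i, mon_of a i))%:R
       * (-1) ^+ (\sum_(i < n) (be i - mon_of a i))%N)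
    * (monom y [ffun i => (be i - mon_of a i)%N] * phi (mon_of a)).
Proof.
rewrite (@lincomb_shift _ _ _ (idx_max be).+1) => [|i]; last first.
  by rewrite ltnS leq_idx_max.
rewrite [RHS]big_mkcond /=; apply: eq_bigr => a _.
case: ifPn => [_|/forallPn[i hi]]; last first.
  by rewrite shift_coef0 ?mul0r //; exists i; rewrite ltnNge.
rewrite !mulrA; congr (_ * _).
rewrite /shift_coef /monom natr_prod expr_sum -!big_split /=.
apply: eq_bigr => i _; rewrite !ffunE mxE mulr_natl.
by rewrite mulrnAl -exprMn mulN1r.
Qed.

End Shift.

(** * Operator polynomials *)

Section OperatorPolynomials.
Variables (R : realType) (V : lmodType R) (n : nat) (ip : V -> V -> R).
Variable J : option (V -> V).
Hypothesis rip : real_inner_product ip.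
Hypothesis hJ : if J is Some j then complex_structure ip j else True.
Local Notation opol := (@is_opoly R V n ip J).
Implicit Types (p q : opoly V n) (A B : V -> V) (x y : 'rV[R]_n) (u v : V).
Implicit Types al be ga : mindex n.

Definition opoly_linear (L : opoly V n -> R) := forall c p q, opol p -> opol q ->
  L (opadd (opscale c p) q) = c * L p + L q.

Lemma opoly_zero : opol (fun=> @zeroop R V).
Proof. by split; [exists 0%N|move=> al; exact: Bh_zero]. Qed.

Lemma opoly_lin c p q : opol p -> opol q -> opol (opadd (opscale c p) q).
Proof.
move=> [[d hp] bp] [[e hq] bq]; split; last by move=> al; exact: Bh_lin.
exists (maxn d e) => al [i]; rewrite geq_max => /andP[di ei].
apply/funext => v; rewrite /opadd /opscale hp; last by exists i.
by rewrite hq; [rewrite /zeroop scaler0 addr0|exists i].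
Qed.

Lemma opoly_elem A al : Bh ip J A -> opol (elem A al).
Proof.
move=> hA; split; last first.
  by move=> be; rewrite /elem; case: eqP => // _; exact: Bh_zero.
exists (idx_max al).+1 => be [i hi]; rewrite /elem; case: eqP => // beal.
by move: hi; rewrite beal ltnNge leq_idx_max.
Qed.

Lemma opoly_linear0 L : opoly_linear L -> L (fun=> @zeroop R V) = 0.
Proof.
move=> Ll; have := Ll 1 _ _ opoly_zero opoly_zero.
have -> : opadd (opscale 1 (fun=> @zeroop R V)) (fun=> @zeroop R V) =
    (fun=> @zeroop R V) :> opoly V n.
  by apply/funext => al; apply/funext => v; rewrite /opadd /opscale scaler0 addr0.
by rewrite mul1r; lra.
Qed.

Lemma opoly_sum (I : Type) (r : seq I) (P : pred I) (c : I -> R) (p : I -> opoly V n) :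
  (forall i, opol (p i)) ->
  opol (fun al v => \sum_(i <- r | P i) c i *: p i al v) /\
  (forall L, opoly_linear L -> L (fun al v => \sum_(i <- r | P i) c i *: p i al v) =
    \sum_(i <- r | P i) c i * L (p i)).
Proof.
move=> hp; elim: r => [|i r [IH1 IH2]].
  have -> : (fun al v => \sum_(i <- [::] | P i) c i *: p i al v) = (fun=> @zeroop R V).
    by apply/funext => al; apply/funext => v; rewrite big_nil.
  by split=> [|L Ll]; [exact: opoly_zero|rewrite big_nil opoly_linear0].
case Pi : (P i); last first.
  have -> : (fun al v => \sum_(j <- i :: r | P j) c j *: p j al v) =
      (fun al v => \sum_(j <- r | P j) c j *: p j al v).
    by apply/funext => al; apply/funext => v; rewrite big_cons Pi.
  by split=> // L Ll; rewrite big_cons Pi IH2.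
have -> : (fun al v => \sum_(j <- i :: r | P j) c j *: p j al v) =
    opadd (opscale (c i) (p i)) (fun al v => \sum_(j <- r | P j) c j *: p j al v).
  by apply/funext => al; apply/funext => v; rewrite big_cons Pi.
split=> [|L Ll]; first exact: opoly_lin.
by rewrite Ll // IH2 // big_cons Pi.
Qed.

Lemma opeval_box d p x v : deg_bounded d p ->
  opeval p x v = \sum_(a : {ffun 'I_n -> 'I_d}) monom x (mon_of a) *: p (mon_of a) v.
Proof.
move=> hd; rewrite /opeval.
apply: (sum_mon_of_indep (F := fun al => monom x al *: p al v)) => al hal.
  rewrite (_ : p al = @zeroop R V) ?scaler0 //; move: al hal.
  rewrite /deg_bound; case: pselect => [h al|]; last by case; exists d.
  exact: (projT2 (cid h)).
by rewrite hd // scaler0.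
Qed.

Lemma opeval_linear x u v : opoly_linear (fun p => ip (opeval p x u) v).
Proof.
move=> c p q hp hq; have [[f hf] _] := opoly_lin c hp hq.
have [[d hd] _] := hp; have [[e he] _] := hq.
pose N := maxn f (maxn d e).
have w k (r : opoly V n) : (k <= N)%N -> deg_bounded k r -> deg_bounded N r.
  by move=> kN hr al [i hi]; apply: hr; exists i; exact: leq_trans hi.
rewrite !(@opeval_box N); [|apply: w he|apply: w hd|apply: w hf];
  rewrite ?leq_max ?leqnn ?orbT //.
rewrite -(ip_lin rip); congr ip; rewrite scaler_sumr -big_split.
apply: eq_bigr => a _; rewrite /opadd /opscale scalerDr; congr (_ + _).
by rewrite !scalerA mulrC.
Qed.

Lemma opeval_elem A al x v : opeval (elem A al) x v = monom x al *: A v.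
Proof.
have hd : deg_bounded (idx_max al).+1 (elem A al).
  move=> be [i hi]; rewrite /elem; case: eqP => // beal.
  by move: hi; rewrite beal ltnNge leq_idx_max.
rewrite (opeval_box _ _ hd).
rewrite (sum_mon_of_pick (al := al) (F := fun be => monom x be *: elem A al be v)).
- by rewrite /elem eqxx.
- by move=> i; rewrite ltnS leq_idx_max.
- by move=> be; rewrite /elem => /negbTE ->; rewrite /zeroop scaler0.
Qed.

Lemma opoly_decomp d p : deg_bounded d p ->
  p = (fun al v => \sum_(a : {ffun 'I_n -> 'I_d})
         1 *: elem (p (mon_of a)) (mon_of a) al v).
Proof.
move=> hd; apply/funext => al; apply/funext => v.
have [[i hi]|h] := pselect (exists i, (d <= al i)%N).
  rewrite hd; last by exists i.
  rewrite big1 // => a _; rewrite /elem; case: eqP => [ala|_]; last by rewrite scaler0.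
  by move: hi; rewrite ala ffunE leqNgt ltn_ord.
have h' i : (al i < d)%N by rewrite ltnNge; apply/negP => hi; apply: h; exists i.
rewrite (sum_mon_of_pick (al := al) (F := fun be => 1 *: elem (p be) be al v)) //.
  by rewrite /elem eqxx scale1r.
by move=> be; rewrite /elem eq_sym => /negbTE ->; rewrite /zeroop scaler0.
Qed.

Lemma mulmono_elem A al ga : mulmono (elem A al) ga = elem A (idxD al ga).
Proof.
apply/funext => be; rewrite /mulmono /elem; case: ifPn => [/forallP h|/forallPn[i hi]].
  congr (if _ then _ else _); apply/eqP/eqP => [<-|->]; apply/ffunP => i.
    by rewrite !ffunE subnK.
  by rewrite !ffunE addnK.
case: eqP => // beE; move: hi; rewrite beE ffunE.
by rewrite leq_addl.
Qed.

Lemma opoly_mulmono p ga x u v : opol p -> opol (mulmono p ga) /\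
  ip (opeval (mulmono p ga) x u) v = monom x ga * ip (opeval p x u) v.
Proof.
move=> [[d hd] bp].
have -> : mulmono p ga = (fun al v => \sum_(a : {ffun 'I_n -> 'I_d})
    1 *: elem (p (mon_of a)) (idxD (mon_of a) ga) al v).
  apply/funext => al; apply/funext => w; rewrite [in LHS](opoly_decomp hd) /mulmono.
  under [RHS]eq_bigr do rewrite -mulmono_elem.
  rewrite /mulmono; case: ifP => // _.
  by rewrite big1 // => a _; rewrite scaler0.
have he (a : {ffun 'I_n -> 'I_d}) : opol (elem (p (mon_of a)) (idxD (mon_of a) ga)).
  exact: opoly_elem.
have [h1 h2] := opoly_sum (index_enum _) xpredT (fun=> 1) he.
split=> //; rewrite (h2 _ (@opeval_linear x u v)) (opeval_box _ _ hd).
rewrite (ip_suml rip) mulr_sumr; apply: eq_bigr => a _.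
by rewrite mul1r opeval_elem !(ipZl rip) monomD mulrCA mulrA.
Qed.

Variable T : opoly V n -> opoly V n.
Hypothesis Topoly : forall p, opol p -> opol (T p).
Hypothesis Tlin : forall c p q, opol p -> opol q ->
  T (opadd (opscale c p) q) = opadd (opscale c (T p)) (T q).

Lemma opeval_T_linear x u v : opoly_linear (fun p => ip (opeval (T p) x u) v).
Proof.
by move=> c p q hp hq; rewrite Tlin // opeval_linear //; exact: Topoly.
Qed.

Definition moment_of A x u v : mindex n -> R :=
  fun al => ip (opeval (T (elem A al)) x u) v.

Definition qmoment A y u v : mindex n -> R :=
  fun be => ip (opeval (Qcan T be A) y u) v.

Lemma qmoment_opoly be A : Bh ip J A -> opol (Qcan T be A).
Proof.
move=> hA; have h (a : {ffun 'I_n -> 'I_(\max_(i < n) be i).+1}) :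
    opol (mulmono (T (elem A (mon_of a))) [ffun i => (be i - mon_of a i)%N]).
  exact: (opoly_mulmono _ 0 0 0 (Topoly (opoly_elem _ hA))).1.
exact: (opoly_sum (index_enum _) _ _ h).1.
Qed.

Lemma qmomentE A y u v be : Bh ip J A ->
  qmoment A y u v be = lincomb (moment_of A y u v) (shift_list (- y) be).
Proof.
move=> hA; have h (a : {ffun 'I_n -> 'I_(\max_(i < n) be i).+1}) :
    opol (mulmono (T (elem A (mon_of a))) [ffun i => (be i - mon_of a i)%N]).
  exact: (opoly_mulmono _ 0 0 0 (Topoly (opoly_elem _ hA))).1.
rewrite lincomb_shift_qcan /qmoment /Qcan.
rewrite ((opoly_sum (index_enum _) _ _ h).2 _ (@opeval_linear y u v)).
apply: eq_bigr => a _; congr (_ * _).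
exact: (opoly_mulmono _ y u v (Topoly (opoly_elem _ hA))).2.
Qed.

(** Inverts [qmomentE]; the converse implication needs it to recover [T] from the [Q_be]. *)
Lemma moment_of_shift A y u v al : Bh ip J A ->
  moment_of A y u v al = lincomb (qmoment A y u v) (shift_list y al).
Proof.
move=> hA; rewrite -[LHS](shift_inv _ y); congr lincomb.
by apply/funext => be; rewrite qmomentE.
Qed.

Lemma moment_of_lin A B c y u v al : Bh ip J A -> Bh ip J B ->
  moment_of (fun w => c *: A w + B w) y u v al =
  c * moment_of A y u v al + moment_of B y u v al.
Proof.
move=> hA hB; rewrite /moment_of.
rewrite -(@opeval_T_linear y u v c) //; [|exact: opoly_elem|exact: opoly_elem].
congr (ip (opeval (T _) y u) v); apply/funext => be; apply/funext => w.
by rewrite /elem /opadd /opscale; case: eqP => // _; rewrite /zeroop scaler0 addr0.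
Qed.

End OperatorPolynomials.

(** * Signed moment functionals *)

Section SignedMoments.
Variables (R : realType) (n : nat) (D : set (Borel R n)).
Hypothesis cD : compact (D : set 'rV[R]_n).
Let mD : measurable (D : set (Borel R n)) := measurable_borel_compact cD.
Implicit Types (m : mindex n -> R) (S : set (Borel R n)).

Lemma moment_positiveD m m' : moment_positive D m -> moment_positive D m' ->
  moment_positive D (fun al => m al + m' al).
Proof.
move=> h h' s hs; have -> : lincomb (fun al => m al + m' al) s =
    1 * lincomb m s + lincomb m' s.
  by rewrite -lincomb_phiD; congr lincomb; apply/funext => al; rewrite mul1r.
by rewrite mul1r addr_ge0 ?h ?h'.
Qed.

Lemma moment_positive0 : moment_positive D (fun=> 0).
Proof. by move=> s _; rewrite /lincomb big1 // => a _; rewrite mulr0. Qed.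

Lemma moment_positiveZ c m : 0 <= c -> moment_positive D m ->
  moment_positive D (fun al => c * m al).
Proof.
move=> c0 h s hs; have -> : lincomb (fun al => c * m al) s =
    c * lincomb m s + lincomb (fun=> 0) s.
  by rewrite -lincomb_phiD; congr lincomb; apply/funext => al; rewrite addr0.
by rewrite addr_ge0 ?moment_positive0 // mulr_ge0 // h.
Qed.

Lemma integral_EFin_monom (mu : {finite_measure set (Borel R n) -> \bar R}) al :
  (\int[mu]_(t in D) (monom t al)%:E)%E = (\int[mu]_(t in D) monom t al)%:E.
Proof.
by rewrite fineK //; apply: (integrable_fin_num mD); exact: (integrable_monom cD).
Qed.

(** The sum of the two Riesz measures has moments [m + m'], and [eq_riesz_outer] identifies any
    measure with the outer measure built from its moments. *)
Lemma riesz_outerD m m' S : moment_positive D m -> moment_positive D m' ->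
  measurable S -> S `<=` D ->
  riesz_outer D (fun al => m al + m' al) S = riesz_outer D m S + riesz_outer D m' S.
Proof.
move=> h h' mS SD.
pose mu := riesz_measure cD h; pose mu' := riesz_measure cD h'.
pose la := measure_add mu mu'.
have laD : (la D < +oo)%E by rewrite /la measure_addE; exact: ltry.
have E : (fun al => \int[la]_(x in D) monom x al) = (fun al => m al + m' al).
  apply/funext => al.
  have i1 := integrable_monom cD mu al; have i2 := integrable_monom cD mu' al.
  rewrite -(riesz_measure_moment cD h) -(riesz_measure_moment cD h').
  rewrite /Rintegral (integral_measure_add mD i1 i2) fineD //.
    exact: (integrable_fin_num mD i1).
  exact: (integrable_fin_num mD i2).
have := eq_riesz_outer cD laD mS SD; rewrite E => <-.
by rewrite fine_finite_measureD.
Qed.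

Lemma riesz_outerZ c m S : 0 <= c -> moment_positive D m ->
  measurable S -> S `<=` D ->
  riesz_outer D (fun al => c * m al) S = c * riesz_outer D m S.
Proof.
move=> c0 h mS SD.
pose mu := riesz_measure cD h; pose la := mscale (NngNum c0) mu.
have laD : (la D < +oo)%E by exact: ltry.
have E : (fun al => \int[la]_(x in D) monom x al) = (fun al => c * m al).
  apply/funext => al.
  have i1 := integrable_monom cD mu al.
  have jp := integrable_funepos mD i1; have ip := integrable_fin_num mD jp.
  have jm := integrable_funeneg mD i1; have im := integrable_fin_num mD jm.
  rewrite -(riesz_measure_moment cD h) /Rintegral.
  rewrite integralE [in RHS]integralE !ge0_integral_mscale //.
  - by rewrite -(fineK ip) -(fineK im) /= mulrBr.
  - exact: (measurable_int mu jm).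
  - exact: (measurable_int mu jp).
by have := eq_riesz_outer cD laD mS SD; rewrite E => <-.
Qed.

Lemma riesz_outer_moments0 S : riesz_outer D (fun=> 0) S = 0.
Proof.
apply/eqP; rewrite eq_le (riesz_outer_ge0 moment_positive0) andbT.
by apply: (riesz_outer_le moment_positive0); exact: (cover_bound_total moment_positive0).
Qed.

Definition signed_rep m (p : (mindex n -> R) * (mindex n -> R)) :=
  [/\ moment_positive D p.1, moment_positive D p.2 &
      forall al, m al = p.1 al - p.2 al].

Definition signed_moments m := exists p, signed_rep m p.

(** The decomposition is an arbitrary choice; by [signed_measureE] it does not affect the value on
    measurable subsets of [D]. *)
Definition signed_measure m S : R :=
  if pselect (signed_moments m) is left h
  then riesz_outer D (projT1 (cid h)).1 S - riesz_outer D (projT1 (cid h)).2 S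
  else 0.

(** Two decompositions satisfy [p.1 + q.2 = q.1 + p.2], an identity between positive moment
    sequences to which additivity applies. *)
Lemma signed_measureE m p S : signed_rep m p -> measurable S -> S `<=` D ->
  signed_measure m S = riesz_outer D p.1 S - riesz_outer D p.2 S.
Proof.
move=> hp mS SD; rewrite /signed_measure; case: pselect => [h|]; last first.
  by case; exists p.
move: (projT1 (cid h)) (projT2 (cid h)) => q hq {h}.
have [p1 p2 pE] := hp; have [q1 q2 qE] := hq.
have := @riesz_outerD q.1 p.2 S q1 p2 mS SD; have := @riesz_outerD p.1 q.2 S p1 q2 mS SD.
have -> : (fun al => p.1 al + q.2 al) = (fun al => q.1 al + p.2 al).
  by apply/funext => al; have := pE al; rewrite qE; lra.
by lra.
Qed.

Lemma signed_moments_pos m : moment_positive D m -> signed_rep m (m, fun=> 0).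
Proof. by move=> h; split=> //= [|al]; [exact: moment_positive0|rewrite subr0]. Qed.

Lemma signed_measure_pos m S : moment_positive D m -> measurable S -> S `<=` D ->
  signed_measure m S = riesz_outer D m S.
Proof.
move=> h mS SD; rewrite (signed_measureE (signed_moments_pos h)) //=.
by rewrite riesz_outer_moments0 subr0.
Qed.

Lemma signed_measure_lin c m m' : signed_moments m -> signed_moments m' ->
  signed_moments (fun al => c * m al + m' al) /\
  forall S, measurable S -> S `<=` D ->
  signed_measure (fun al => c * m al + m' al) S =
  c * signed_measure m S + signed_measure m' S.
Proof.
move=> [p hp] [q hq]; have [p1 p2 pE] := hp; have [q1 q2 qE] := hq.
have [c0|c0] := leP 0 c.
  have cp1 := moment_positiveZ c0 p1; have cp2 := moment_positiveZ c0 p2.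
  have hr : signed_rep (fun al => c * m al + m' al)
      (fun al => c * p.1 al + q.1 al, fun al => c * p.2 al + q.2 al).
    split=> /= [||al]; [exact: moment_positiveD|exact: moment_positiveD|].
    by rewrite pE qE; ring.
  split=> [|S mS SD]; first by eexists; exact: hr.
  rewrite (signed_measureE hr) // (signed_measureE hp) // (signed_measureE hq) //=.
  by rewrite !riesz_outerD // !riesz_outerZ //; ring.
(* For negative [c] the two parts of [m] change places, so that all coefficients stay
   nonnegative. *)
have nc0 : 0 <= - c by rewrite oppr_ge0 ltW.
have cp1 := moment_positiveZ nc0 p1; have cp2 := moment_positiveZ nc0 p2.
have hr : signed_rep (fun al => c * m al + m' al)
    (fun al => - c * p.2 al + q.1 al, fun al => - c * p.1 al + q.2 al).
  split=> /= [||al]; [exact: moment_positiveD|exact: moment_positiveD|].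
  by rewrite pE qE; ring.
split=> [|S mS SD]; first by eexists; exact: hr.
rewrite (signed_measureE hr) // (signed_measureE hp) // (signed_measureE hq) //=.
by rewrite !riesz_outerD // !riesz_outerZ //; ring.
Qed.

Lemma signed_measure_jordan m : signed_moments m ->
  exists mu nu : {finite_measure set (Borel R n) -> \bar R},
    (forall S, measurable S -> S `<=` D ->
       signed_measure m S = fine (mu S) - fine (nu S)) /\
    (forall al, m al = \int[mu]_(x in D) monom x al - \int[nu]_(x in D) monom x al).
Proof.
move=> [p hp]; have [p1 p2 pE] := hp.
exists (riesz_measure cD p1), (riesz_measure cD p2); split.
  by move=> S mS SD; rewrite (signed_measureE hp).
by move=> al; rewrite !riesz_measure_moment.
Qed.

End SignedMoments.

(** * From positivity to map-valued measures *)

Section Translate.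
Variables (R : realType) (n : nat) (K : set 'rV[R]_n) (y : 'rV[R]_n).

Lemma translate_compact : compact K -> compact (translate K y : set 'rV[R]_n).
Proof.
move=> cK; have -> : (translate K y : set 'rV[R]_n) = (fun x => x - y) @` K.
  by apply/seteqP; split=> [x [k Kk ->]|x [k Kk <-]]; exists k.
apply: continuous_compact => //; apply: continuous_subspaceT => x.
by apply: continuousB; [exact: cvg_id|exact: cst_continuous].
Qed.

End Translate.

Section PositiveOperatorMoments.
Variables (R : realType) (V : lmodType R) (n : nat) (ip : V -> V -> R).
Variable J : option (V -> V).
Hypothesis hV : hilbert_space ip J.
Variable T : opoly V n -> opoly V n.
Hypothesis Topoly : forall p, is_opoly ip J p -> is_opoly ip J (T p).
Hypothesis Tlin : forall c p q, is_opoly ip J p -> is_opoly ip J q ->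
  T (opadd (opscale c p) q) = opadd (opscale c (T p)) (T q).
Variables (K : set 'rV[R]_n) (y : 'rV[R]_n).
Hypothesis cK : compact K.
Hypothesis Ky : K y.
Hypothesis Tpos : forall p, Pos ip J K p -> Pos ip J K (T p).

Let rip : real_inner_product ip. Proof. by case: hV. Qed.
Let cV : complete_space ip. Proof. by case: hV. Qed.
Let hJ : if J is Some j then complex_structure ip j else True.
Proof. by case: hV. Qed.
Let D : set (Borel R n) := translate K y.
Let cD : compact (D : set 'rV[R]_n) := @translate_compact _ _ _ y cK.
Local Notation qm := (qmoment ip T).
Implicit Types (A B : V -> V) (u v w : V) (S : set (Borel R n)).

Lemma Bh_opeval (p : opoly V n) x : is_opoly ip J p -> Bh ip J (opeval p x).
Proof.
move=> [_ bp]; rewrite /opeval; elim: (index_enum _) => [|a r IH].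
  have -> : (fun v => \sum_(a <- [::] : seq {ffun 'I_n -> 'I_(deg_bound p)})
      monom x (mon_of a) *: p (mon_of a) v) = @zeroop R V.
    by apply/funext => v; rewrite big_nil.
  exact: Bh_zero.
have -> : (fun v => \sum_(b <- a :: r) monom x (mon_of b) *: p (mon_of b) v) =
    fun v => monom x (mon_of a) *: p (mon_of a) v +
      \sum_(b <- r) monom x (mon_of b) *: p (mon_of b) v.
  by apply/funext => v; rewrite big_cons.
exact: Bh_lin.
Qed.

Lemma Bh_Qcan be A : Bh ip J A -> Bh ip J (opeval (Qcan T be A) y).
Proof. by move=> hA; apply: Bh_opeval; exact: (qmoment_opoly rip hJ Topoly). Qed.

Lemma qmoment_linl A a u w v : Bh ip J A ->
  qm A y (a *: u + w) v = (fun be => a * qm A y u v be + qm A y w v be).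
Proof.
move=> hA; apply/funext => be; rewrite /qmoment.
by have [-> _ _ _] := Bh_Qcan be hA; rewrite (ip_lin rip).
Qed.

Lemma qmoment_sym A u v : Bh ip J A -> qm A y u v = qm A y v u.
Proof.
move=> hA; apply/funext => be; rewrite /qmoment.
by have [_ _ h _] := Bh_Qcan be hA; rewrite h (ip_sym rip).
Qed.

Lemma qmoment_linA A B c u v : Bh ip J A -> Bh ip J B ->
  qm (fun w => c *: A w + B w) y u v = (fun be => c * qm A y u v be + qm B y u v be).
Proof.
move=> hA hB; apply/funext => be.
rewrite !(qmomentE rip hJ Topoly) //; last exact: Bh_lin.
rewrite -lincomb_phiD; congr lincomb; apply/funext => al.
exact: (moment_of_lin rip hJ Topoly Tlin).
Qed.

Lemma qmoment_positive A v : Bh ip J A -> psd ip A ->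
  moment_positive D (qm A y v v).
Proof.
move=> hA pA s hs.
(* [s'] lists the polynomial [s(x - y)], which is nonnegative on [K]; times [A] it belongs to
   [Pos K]. *)
pose s' := flatten [seq lscale a.1 (shift_list (- y) a.2) | a <- s].
have s'E (phi : mindex n -> R) : lincomb phi s' =
    lincomb (fun be => lincomb phi (shift_list (- y) be)) s.
  rewrite /s'; elim: (s) => [|a r IH] /=; first by rewrite !lincomb_nil.
  by rewrite lincomb_cat lincomb_scale IH lincomb_cons.
have hp (a : R * mindex n) : is_opoly ip J (elem A a.2) by exact: opoly_elem.
have [op opL] := opoly_sum rip hJ s' xpredT (fun a => a.1) hp.
have [|_ /(_ y Ky v)] := @Tpos _ (conj op _).
  move=> x Kx w; rewrite (opL _ (opeval_linear rip hJ x w w)).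
  under eq_bigr do rewrite opeval_elem (ipZl rip) mulrA.
  rewrite -mulr_suml mulr_ge0 ?pA //.
  rewrite -/(lincomb (monom x) s') s'E.
  have -> : (fun be => lincomb (monom x) (shift_list (- y) be)) =
      (monom (x - y) : mindex n -> R).
    by apply/funext => be; rewrite lincomb_shift_monom.
  by apply: hs; exists x.
rewrite (opL _ (opeval_T_linear rip hJ Topoly Tlin y v v)).
rewrite -/(lincomb (moment_of ip T A y v v) s') s'E.
suff -> : qm A y v v = (fun be => lincomb (moment_of ip T A y v v) (shift_list (- y) be))
  by [].
by apply/funext => be; rewrite (qmomentE rip hJ Topoly).
Qed.

Lemma qmoment0l A v : Bh ip J A -> qm A y 0 v = (fun=> 0).
Proof.
move=> hA; have := qmoment_linl (-1) v v v hA; rewrite scaleN1r addNr => ->.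
by apply/funext => be; rewrite mulN1r addNr.
Qed.

(** The vanishing last term gives the right-hand side the shape [c * m + m'] expected by
    [signed_measure_lin]. *)
Lemma qmoment_J A j u v : J = Some j -> Bh ip J A ->
  qm A y (j u) v = (fun be => -1 * qm A y u (j v) be + qm A y 0 v be).
Proof.
move=> EJ hA; rewrite qmoment0l //; apply/funext => be; rewrite addr0 /qmoment.
have [_ _ _ hj] := Bh_Qcan be hA; rewrite EJ in hj; rewrite hj.
have := hJ; rewrite EJ => -[_ jj jip].
by rewrite -(jip (opeval _ y u)) jj (ipNr rip); ring.
Qed.

Lemma qmoment_signed_diag A v : Bh ip J A -> signed_moments D (qm A y v v).
Proof.
move=> hA; have [c c0 pc] := psd_shift rip hA.
have hid := Bh_id ip J.
have hs : Bh ip J (fun w => c *: w + A w) := Bh_lin rip hJ c hid hA.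
have pid : psd ip (fun w => w) by move=> w; exact: (ip_ge0 rip).
exists (qm (fun w => c *: w + A w) y v v, fun be => c * qm (fun w => w) y v v be).
split=> /=; first exact: qmoment_positive.
  by apply: moment_positiveZ => //; exact: qmoment_positive.
by move=> be; rewrite (qmoment_linA c v v hid hA); ring.
Qed.

Lemma qmoment_signed A u v : Bh ip J A -> signed_moments D (qm A y u v).
Proof.
move=> hA.
(* Polarisation: twice the [(u, v)] moment is the diagonal one at [u + v] minus those at [u] and
   [v]. The zero vector only fills the second slot of the last combination. *)
have [h1 _] := signed_measure_lin cD (-1) (qmoment_signed_diag v hA)
  (qmoment_signed_diag (u + v) hA).
have [h2 _] := signed_measure_lin cD (-1) (qmoment_signed_diag u hA) h1.
have [h3 _] := signed_measure_lin cD 2^-1 h2 (qmoment_signed_diag 0 hA).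
suff -> : qm A y u v = (fun be => 2^-1 *
  (-1 * qm A y u u be + (-1 * qm A y v v be + qm A y (u + v) (u + v) be))
  + qm A y 0 0 be) by [].
apply/funext => be; rewrite qmoment0l //.
have E := qmoment_linl 1 u v; rewrite !scale1r in E.
rewrite E // !(qmoment_sym _ (u + v)) // !E // (qmoment_sym v u) //.
by field.
Qed.

Definition qform A S u v : R := signed_measure D (qm A y u v) S.

Section Form.
Variable S : set (Borel R n).
Hypotheses (mS : measurable S) (SD : S `<=` D).

Lemma qform_linl A a u w v : Bh ip J A ->
  qform A S (a *: u + w) v = a * qform A S u v + qform A S w v.
Proof.
move=> hA; rewrite /qform qmoment_linl //.
have [_ ->//] := signed_measure_lin cD a (qmoment_signed u v hA) (qmoment_signed w v hA).
Qed.

Lemma qform_linA A B c u v : Bh ip J A -> Bh ip J B ->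
  qform (fun w => c *: A w + B w) S u v = c * qform A S u v + qform B S u v.
Proof.
move=> hA hB; rewrite /qform qmoment_linA //.
have [_ ->//] := signed_measure_lin cD c (qmoment_signed u v hA) (qmoment_signed u v hB).
Qed.

Lemma qform_sym A u v : Bh ip J A -> qform A S u v = qform A S v u.
Proof. by move=> hA; rewrite /qform qmoment_sym. Qed.

Lemma qform_ge0 A v : Bh ip J A -> psd ip A -> 0 <= qform A S v v.
Proof.
move=> hA pA; have h := qmoment_positive v hA pA.
by rewrite /qform (signed_measure_pos cD h) // (riesz_outer_ge0 h).
Qed.

(** On the diagonal the value at [S] is at most the total mass [<Q_0(A)(y) w, w>], and [Q_0(A)(y)]
    is bounded. Cauchy-Schwarz for the form carries this off the diagonal. *)
Lemma qform_bounded_psd A : Bh ip J A -> psd ip A ->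
  exists C : R, forall u v, `|qform A S u v| <= C * (hnorm ip u * hnorm ip v).
Proof.
move=> hA pA; have [_ [C hC] _ _] := Bh_Qcan (@idx0 n) hA.
exists `|C| => u v.
have diag w : qform A S w w <= `|C| * hnorm ip w ^+ 2.
  have h := qmoment_positive w hA pA.
  rewrite /qform (signed_measure_pos cD h) //.
  apply: (@le_trans _ _ (qm A y w w (@idx0 n))).
    by apply: (riesz_outer_le h); exact: (cover_bound_total h).
  rewrite /qmoment (le_trans (ler_norm _)) // (le_trans (cauchy_schwarz rip _ _)) //.
  rewrite expr2 mulrA ler_wpM2r ?hnorm_ge0 // (le_trans (hC w)) //.
  by rewrite ler_wpM2r ?hnorm_ge0 // ler_norm.
rewrite -(@ler_pXn2r _ 2) ?nnegrE ?mulr_ge0 ?hnorm_ge0 //.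
rewrite real_normK ?num_real //.
apply: (@le_trans _ _ (qform A S u u * qform A S v v)).
  apply: form_cauchy_schwarz => [a x z w|x z|x]; first exact: qform_linl.
    exact: qform_sym.
  exact: qform_ge0.
have -> : (`|C| * (hnorm ip u * hnorm ip v)) ^+ 2 =
    (`|C| * hnorm ip u ^+ 2) * (`|C| * hnorm ip v ^+ 2) by ring.
by rewrite ler_pM // qform_ge0.
Qed.

Lemma qform_bounded A : Bh ip J A ->
  exists C : R, forall u v, `|qform A S u v| <= C * (hnorm ip u * hnorm ip v).
Proof.
move=> hA; have [c c0 pc] := psd_shift rip hA.
have hid := Bh_id ip J.
have hs : Bh ip J (fun w => c *: w + A w) := Bh_lin rip hJ c hid hA.
have pid : psd ip (fun w => w) by move=> w; exact: (ip_ge0 rip).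
have [C1 h1] := qform_bounded_psd hs pc; have [C2 h2] := qform_bounded_psd hid pid.
exists (C1 + c * C2) => u v.
have -> : qform A S u v = qform (fun w => c *: w + A w) S u v -
    c * qform (fun w => w) S u v by rewrite qform_linA //; ring.
rewrite (le_trans (ler_normB _ _)) // mulrDl lerD // normrM ger0_norm //.
by rewrite -mulrA ler_wpM2l.
Qed.

Lemma qform_J A j u v : J = Some j -> Bh ip J A ->
  qform A S (j u) v = - qform A S u (j v).
Proof.
move=> EJ hA; have q0 : qform A S 0 v = 0.
  by have := qform_linl (-1) v v v hA; rewrite scaleN1r addNr => ->; ring.
rewrite /qform (qmoment_J u v EJ hA).
have [_ ->//] := signed_measure_lin cD (-1) (qmoment_signed u (j v) hA)
  (qmoment_signed 0 v hA).
by rewrite -[X in _ + X]/(qform A S 0 v) q0; ring.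
Qed.

Lemma qform_operator A : Bh ip J A ->
  exists2 B, Bh ip J B & forall u v, ip (B u) v = qform A S u v.
Proof.
move=> hA; have [C hC] := qform_bounded hA.
apply: (operator_of_form rip cV hJ (C := C)) => //.
- by move=> *; exact: qform_linl.
- by move=> *; exact: qform_sym.
by case EJ : J => [j|//] u v; exact: qform_J.
Qed.

End Form.

Lemma signed_measure_on_finite_measures (m : set (Borel R n) -> R)
    (mu nu : {finite_measure set (Borel R n) -> \bar R}) :
  (forall S, measurable S -> S `<=` D -> m S = fine (mu S) - fine (nu S)) ->
  signed_measure_on D m.
Proof.
move=> hm F hF tF.
have mF k : measurable (F k) by case: (hF k).
have FD k : F k `<=` D by case: (hF k).
have mUF : measurable (\bigcup_k F k) by exact: bigcupT_measurable.
have cvg (la : {finite_measure set (Borel R n) -> \bar R}) :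
    (fun N => \sum_(k < N) fine (la (F k))) @ \oo --> fine (la (\bigcup_k F k)).
  have h : (fun N => (\sum_(0 <= k < N) la (F k))%E) @ \oo -->
      (fine (la (\bigcup_k F k)))%:E.
    by rewrite fineK ?fin_num_measure //; exact: measure_semi_sigma_additive.
  have -> : (fun N => \sum_(k < N) fine (la (F k))) =
      fine \o (fun N => (\sum_(0 <= k < N) la (F k))%E).
    apply/funext => N /=; rewrite big_mkord sum_fine // => k _.
    exact: fin_num_measure.
  exact: fine_cvg h.
rewrite hm //; last by move=> x [k _ /FD].
rewrite (_ : (fun N => _) = (fun N => \sum_(k < N) fine (mu (F k)) -
    \sum_(k < N) fine (nu (F k)))).
  exact: (@cvgB _ R^o).
by apply/funext => N; rewrite -sumrB; apply: eq_bigr => k _; rewrite hm.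
Qed.

(** The integral must come out the same for every decomposition: [mu - nu = mu1 - nu1] on [D]
    becomes [mu + nu1 = mu1 + nu], an equality of finite measures. *)
Lemma is_signed_integral_moment (m : set (Borel R n) -> R)
    (mu nu : {finite_measure set (Borel R n) -> \bar R}) be :
  (forall S, measurable S -> S `<=` D -> m S = fine (mu S) - fine (nu S)) ->
  is_signed_integral D m (fun t => monom t be)
    (\int[mu]_(x in D) monom x be - \int[nu]_(x in D) monom x be).
Proof.
move=> hm; have mD : measurable D := measurable_borel_compact cD.
split.
  exists mu, nu => S mS SD; rewrite hm // EFinB !fineK // fin_num_measure //.
move=> mu1 nu1 h; rewrite !(integral_EFin_monom cD) -EFinB; congr EFin.
have E : (\int[measure_add mu nu1]_(x in D) (monom x be)%:E =
    \int[measure_add mu1 nu]_(x in D) (monom x be)%:E)%E.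
  apply: eq_measure_integral => S mS SD.
  suff e : (mu S + nu1 S = mu1 S + nu S)%E.
    exact: (etrans (measure_addE mu nu1 S) (etrans e (esym (measure_addE mu1 nu S)))).
  have := h S mS SD; rewrite hm // -(fineK (fin_num_measure mu S mS)).
  rewrite -(fineK (fin_num_measure nu S mS)) -(fineK (fin_num_measure mu1 S mS)).
  rewrite -(fineK (fin_num_measure nu1 S mS)) -EFinB -!EFinD => -[] /= e.
  by congr EFin; lra.
have i (la : {finite_measure set (Borel R n) -> \bar R}) := integrable_monom cD la be.
move: E; rewrite (integral_measure_add mD (i mu) (i nu1)).
rewrite (integral_measure_add mD (i mu1) (i nu)).
by rewrite !(integral_EFin_monom cD) -!EFinD => -[]; lra.
Qed.

Lemma map_valued_measure_exists :
  exists nu : set (Borel R n) -> (V -> V) -> (V -> V),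
    pos_map_valued_measure ip J D nu /\
    forall A (be : mindex n), Bh ip J A -> forall v,
      is_signed_integral D (fun S => ip (nu S A v) v)
        (fun t : Borel R n => monom t be) (qm A y v v be).
Proof.
(* The operators are chosen for all pairs at once, with a dummy where [S] or [A] is not admissible.
   These independent choices are still linear in [A], because an operator is determined by its
   form. *)
have hB (SA : set (Borel R n) * (V -> V)) : exists B,
    measurable SA.1 -> SA.1 `<=` D -> Bh ip J SA.2 ->
    Bh ip J B /\ forall u v, ip (B u) v = qform SA.2 SA.1 u v.
  have [[mS SD hA]|h] :=
    pselect [/\ measurable SA.1, SA.1 `<=` D & Bh ip J SA.2]; last first.
    by exists id => mS SD hA; case: h.
  by have [B h1 h2] := qform_operator mS SD hA; exists B.
have [f hf] := choice hB; exists (fun S A => f (S, A)).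
have fE S A u v : measurable S -> S `<=` D -> Bh ip J A ->
    ip (f (S, A) u) v = signed_measure D (qm A y u v) S.
  by move=> mS SD hA; have [_ ->] := hf (S, A) mS SD hA.
split; first split.
- move=> S mS SD; split=> [A hA|c A B hA hB']; first by have [] := hf (S, A) mS SD hA.
  apply/funext => u; apply: (ip_inj rip) => v; rewrite (ip_lin rip) !fE //.
    exact: qform_linA.
  exact: Bh_lin.
- move=> A hA v.
  have [mu [nu [h1 _]]] := signed_measure_jordan cD (qmoment_signed v v hA).
  by apply: (signed_measure_on_finite_measures (mu := mu) (nu := nu)) => S mS SD; rewrite fE // h1.
- by move=> A hA pA S mS SD v; rewrite fE //; exact: qform_ge0.
move=> A be hA v.
have [mu [nu [h1 ->]]] := signed_measure_jordan cD (qmoment_signed v v hA).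
by apply: is_signed_integral_moment => S mS SD; rewrite fE // h1.
Qed.

End PositiveOperatorMoments.

(** * From map-valued measures to positivity *)

Section PositivityFromMeasures.
Variables (R : realType) (V : lmodType R) (n : nat) (ip : V -> V -> R).
Variable J : option (V -> V).
Hypothesis hV : hilbert_space ip J.
Variables (K : set 'rV[R]_n) (y : 'rV[R]_n).
Hypothesis cK : compact K.

Let rip : real_inner_product ip. Proof. by case: hV. Qed.
Let hJ : if J is Some j then complex_structure ip j else True.
Proof. by case: hV. Qed.
Let D : set (Borel R n) := translate K y.
Let cD : compact (D : set 'rV[R]_n) := @translate_compact _ _ _ y cK.
Let mD : measurable D := measurable_borel_compact cD.

Variable nu : set (Borel R n) -> (V -> V) -> (V -> V).
Hypothesis hnu : pos_map_valued_measure ip J D nu.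

Lemma map_valued_sum (I : Type) (r : seq I) (c : I -> R) (A : I -> V -> V) S :
  measurable S -> S `<=` D -> (forall i, Bh ip J (A i)) ->
  Bh ip J (fun v => \sum_(i <- r) c i *: A i v) /\
  nu S (fun v => \sum_(i <- r) c i *: A i v) =
    (fun v => \sum_(i <- r) c i *: nu S (A i) v).
Proof.
move=> mS SD hA; have [/(_ S mS SD)[_ lin] _ _] := hnu.
elim: r => [|i r [IH1 IH2]].
  have -> : (fun v => \sum_(i <- [::]) c i *: A i v) = @zeroop R V.
    by apply/funext => v; rewrite big_nil.
  split; first exact: Bh_zero.
  have := lin 1 _ _ (Bh_zero rip hJ) (Bh_zero rip hJ).
  have -> : (fun v => 1 *: @zeroop R V v + @zeroop R V v) = @zeroop R V.
    by apply/funext => v; rewrite /zeroop scaler0 addr0.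
  move=> e; apply/funext => v; rewrite big_nil.
  have := congr1 (fun B => B v) e; rewrite scale1r => e'.
  by apply: (@addrI _ (nu S (@zeroop R V) v)); rewrite addr0 -e'.
have -> : (fun v => \sum_(j <- i :: r) c j *: A j v) =
    (fun v => c i *: A i v + (fun v => \sum_(j <- r) c j *: A j v) v).
  by apply/funext => v; rewrite big_cons.
split; first exact: Bh_lin.
by rewrite lin // IH2; apply/funext => v; rewrite big_cons.
Qed.

(** * Partition estimate for a fixed vector *)

Section LocalEstimate.
Variables (I : finType) (A : I -> V -> V) (f : I -> Borel R n -> R) (v : V).
Variables mu1 mu2 : I -> {finite_measure set (Borel R n) -> \bar R}.
Hypothesis hA : forall i, Bh ip J (A i).
Hypothesis cf : forall i, continuous (f i : 'rV[R]_n -> R).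
Hypothesis hmu : forall i,
  Defs.jordan_decomp D (fun S => ip (nu S (A i) v) v) (mu1 i) (mu2 i).
Hypothesis fpos : forall t, D t -> psd ip (fun w => \sum_i f i t *: A i w).

(** The integral over [S] of the operator function with coefficients [f i], paired with [v] and
    computed through the chosen decompositions. *)
Let Phi (S : set (Borel R n)) : R :=
  \sum_i (\int[mu1 i]_(t in S) f i t - \int[mu2 i]_(t in S) f i t).

Let La (S : set (Borel R n)) : R := \sum_i (fine (mu1 i S) + fine (mu2 i S)).

Let intf (mu : {finite_measure set (Borel R n) -> \bar R}) i S :
  measurable S -> S `<=` D -> mu.-integrable S (EFin \o f i).
Proof.
move=> mS SD; apply: (integrableS mD mS SD).
have /compact_bounded[M [_ hM]] : compact (f i @` (D : set 'rV[R]_n)).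
  by apply: continuous_compact => //; apply: continuous_subspaceT; exact: cf.
apply: (bounded_integrable cD _ (M := M + 1)).
- by rewrite -ge0_fin_numE // fin_num_measure.
- by apply: measurable_continuous => //; exact: cf.
- by move=> t Dt; apply: (hM (M + 1)); [rewrite ltrDl|exists t].
Qed.

(** Freezing [f] at [t] gives a nonnegative quantity by positivity of [nu]. Both masses enter the
    error, as [mu2 i] is subtracted. The point [t] may lie outside [S], which the cutting in
    [covered_piece] relies on. *)
Lemma small_piece S t e : measurable S -> S `<=` D -> D t -> 0 <= e ->
  (forall s, S s -> forall i, `|f i s - f i t| <= e) -> - e * La S <= Phi S.
Proof.
move=> mS SD Dt e0 he.
have cst (mu : {finite_measure set (Borel R n) -> \bar R}) (c : R) :
    mu.-integrable S (EFin \o (fun=> c)).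
  apply: (integrableS mD mS SD); apply: (approximable_integrable cD).
    by rewrite -ge0_fin_numE // fin_num_measure.
  exact: approximable_cst.
have h0 : 0 <= \sum_i f i t * (fine (mu1 i S) - fine (mu2 i S)).
  have [_ _ pos] := hnu.
  have [B1 B2] := map_valued_sum (index_enum I) (fun i => f i t) mS SD hA.
  have := pos _ B1 (fpos Dt) S mS SD v; rewrite B2 (ip_suml rip).
  congr (0 <= _); apply: eq_bigr => i _; rewrite (ipZl rip); congr (_ * _).
  have := hmu i mS SD; rewrite -(fineK (fin_num_measure (mu1 i) S mS)).
  by rewrite -(fineK (fin_num_measure (mu2 i) S mS)) -EFinB => -[].
rewrite /La /Phi mulr_sumr -subr_ge0 -sumrB (le_trans h0) //.
apply: ler_sum => i _.
have l1 : (f i t - e) * fine (mu1 i S) <= \int[mu1 i]_(s in S) f i s.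
  rewrite -Rintegral_cst //; apply: le_Rintegral => //; [exact: cst|exact: intf|].
  by move=> s Ss; have := he s Ss i; rewrite ler_norml => /andP[]; lra.
have l2 : \int[mu2 i]_(s in S) f i s <= (f i t + e) * fine (mu2 i S).
  rewrite -Rintegral_cst //; apply: le_Rintegral => //; [exact: intf|exact: cst|].
  by move=> s Ss; have := he s Ss i; rewrite ler_norml => /andP[]; lra.
by lra.
Qed.

(** Neighbourhoods are measured by the oscillation of the [f i], so no uniform continuity is
    needed. *)
Let ball_f e (t : Borel R n) : set (Borel R n) :=
  [set s | forall i, `|f i s - f i t| < e].

Lemma open_ball_f e t : open (ball_f e t : set 'rV[R]_n).
Proof.
have -> : ball_f e t =
    \big[setI/setT]_(i <- index_enum I) [set s : 'rV[R]_n | `|f i s - f i t| < e].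
  rewrite -bigcap_seq; apply/seteqP; split=> s /= hs i; first by move=> _; exact: hs.
  exact: (hs i (mem_index_enum i)).
apply: (big_ind (@open 'rV[R]_n)) => [|*|i _]; [exact: openT|exact: openI|].
apply: (@open_comp _ _ (fun s => `|f i s - f i t|) [set x | x < e]); last exact: open_lt.
move=> s _; apply: (@continuous_comp _ _ _ (fun s => f i s - f i t) (@Num.norm R R)).
  apply: (@continuousB R R^o _ (f i) (fun=> f i t)); [exact: cf|exact: cst_continuous].
exact: norm_continuous.
Qed.

(** The induction cuts off the part of [S] in the neighbourhood of the head and leaves the rest to
    the tail; this makes the cover disjoint, and [Phi] and [La] add up. *)
Lemma covered_piece e (r : seq 'rV[R]_n) S : 0 < e ->
  (forall t, t \in r -> D t) -> measurable S -> S `<=` D ->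
  (forall s, S s -> exists2 t, t \in r & ball_f e t s) -> - e * La S <= Phi S.
Proof.
move=> e0; elim: r S => [|t r IH] S rD mS SD hS.
  have -> : S = set0 by apply/seteqP; split=> // s /hS[].
  rewrite /La /Phi !big1 ?mulr0 // => i _; first by rewrite !Rintegral_set0 subrr.
  by rewrite !measure0 addr0.
have mB : measurable (ball_f e t) by apply: measurable_borel_open; exact: open_ball_f.
pose S1 := S `&` ball_f e t; pose S2 := S `\` ball_f e t.
have mS1 : measurable S1 by exact: measurableI.
have mS2 : measurable S2 by exact: measurableD.
have S1D : S1 `<=` D by move=> s [/SD].
have S2D : S2 `<=` D by move=> s [/SD].
have SU : S = S1 `|` S2 by rewrite /S1 /S2 setUIDK.
have dS : [disjoint S1 & S2].
  by apply/disj_setPS => s [[_ h1] [_ h2]].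
have e1 : - e * La S1 <= Phi S1.
  apply: (small_piece (t := t)) => //; first by apply: rD; rewrite inE eqxx.
    exact: ltW.
  by move=> s [_ h] i; exact/ltW/h.
have e2 : - e * La S2 <= Phi S2.
  apply: IH => //; first by move=> u ur; apply: rD; rewrite inE ur orbT.
  move=> s [/hS[u]]; rewrite inE => /predU1P[->//|ur] us _.
  by exists u.
have -> : Phi S = Phi S1 + Phi S2.
  rewrite /Phi -big_split; apply: eq_bigr => i _ /=.
  rewrite [in LHS]SU !Rintegral_setU //; first by ring.
  - by rewrite -SU; exact: intf.
  - by rewrite -SU; exact: intf.
have -> : La S = La S1 + La S2.
  rewrite /La -big_split; apply: eq_bigr => i _ /=.
  have d0 : S1 `&` S2 = set0 by apply/eqP; rewrite -disj_set2E.
  rewrite [in LHS]SU !measureU // !fineD ?fin_num_measure //; ring.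
by rewrite mulrDr lerD.
Qed.

Lemma Phi_ge0 : 0 <= Phi D.
Proof.
have hLa : 0 <= La D by apply: sumr_ge0 => i _; rewrite addr_ge0 // fine_ge0.
apply/ler_addgt0Pr => e' e'0; pose e := e' / (La D + 1).
have La1 : 0 < La D + 1 by lra.
have e0 : 0 < e by exact: divr_gt0.
have := cD; rewrite compact_cover => /(_ _ (D : set 'rV[R]_n) (ball_f e)) [].
- by move=> t _; exact: open_ball_f.
- by move=> t Dt; exists t => // i; rewrite subrr normr0.
move=> E ED hE.
have h : - e * La D <= Phi D.
  apply: (covered_piece (r := finmap.enum_fset E)) => //.
  by move=> t tE; have := ED t tE; rewrite inE.
have -> : e' = e * (La D + 1) by rewrite /e divfK // lt0r_neq0.
by nra.
Qed.

End LocalEstimate.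

Variable T : opoly V n -> opoly V n.
Hypothesis Topoly : forall p, is_opoly ip J p -> is_opoly ip J (T p).
Hypothesis Tlin : forall c p q, is_opoly ip J p -> is_opoly ip J q ->
  T (opadd (opscale c p) q) = opadd (opscale c (T p)) (T q).
Hypothesis hint : forall (A : V -> V) (be : mindex n), Bh ip J A -> forall v,
  is_signed_integral D (fun S => ip (nu S A v) v)
    (fun t : Borel R n => monom t be) (qmoment ip T A y v v be).

Lemma psd_opeval_of_measure (p : opoly V n) : Pos ip J K p -> psd ip (opeval (T p) y).
Proof.
move=> [hp ppos] v; have [[d hd] bp] := hp.
pose I := {ffun 'I_n -> 'I_d}; pose A (a : I) := p (mon_of a).
have hA a : Bh ip J (A a) by exact: bp.
have hj (a : I) : exists m : {finite_measure set (Borel R n) -> \bar R} *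
      {finite_measure set (Borel R n) -> \bar R},
    Defs.jordan_decomp D (fun S => ip (nu S (A a) v) v) m.1 m.2.
  (* The decomposition does not involve the exponent: the one obtained at [idx0] computes every
     moment, since [hint] holds for all decompositions. *)
  by have [[m1 [m2 h]] _] := hint (@idx0 n) (hA a) v; exists (m1, m2).
have [m hm] := choice hj.
pose f (a : I) (t : Borel R n) := monom ((t : 'rV[R]_n) + y) (mon_of a).
have fE a t : f a t = lincomb (monom t) (shift_list y (mon_of a)).
  by rewrite lincomb_shift_monom.
have := @Phi_ge0 I A f v (fun a => (m a).1) (fun a => (m a).2) hA.
have E : ip (opeval (T p) y v) v =
    \sum_a (\int[(m a).1]_(t in D) f a t - \int[(m a).2]_(t in D) f a t).
  have he (a : I) : is_opoly ip J (elem (p (mon_of a)) (mon_of a)) by exact: opoly_elem.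
  have [_ hL] := opoly_sum rip hJ (index_enum I) xpredT (fun=> 1) he.
  rewrite [in LHS](opoly_decomp hd) (hL _ (opeval_T_linear rip hJ Topoly Tlin y v v)).
  apply: eq_bigr => a _; rewrite mul1r -/(moment_of ip T (A a) y v v (mon_of a)).
  rewrite (moment_of_shift rip hJ Topoly) //.
  have -> : qmoment ip T (A a) y v v = (fun be => -1 *
      (\int[(m a).2]_(t in D) monom t be) + \int[(m a).1]_(t in D) monom t be).
    apply/funext => be; have [_ /(_ _ _ (hm a))] := hint be (hA a) v.
    by rewrite !(integral_EFin_monom cD) -EFinB => -[->]; ring.
  have fin (mu : {finite_measure set (Borel R n) -> \bar R}) : (mu D < +oo)%E.
    by rewrite -ge0_fin_numE // fin_num_measure.
  rewrite lincomb_phiD -(Rintegral_lincomb cD (fin _)) -(Rintegral_lincomb cD (fin _)).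
  rewrite mulN1r addrC; congr (_ - _); apply: eq_Rintegral => t _; by rewrite fE.
rewrite E; apply.
- move=> a t; have -> : (f a : 'rV[R]_n -> R) =
    (fun t => lincomb (monom t) (shift_list y (mon_of a))) by apply/funext => s.
  exact: lincomb_continuous.
- exact: hm.
- move=> t [k Kk tk] w; have -> : \sum_i f i t *: A i w = opeval p k w.
    by rewrite (opeval_box _ _ hd); apply: eq_bigr => a _; rewrite /f tk subrK.
  exact: ppos.
Qed.

End PositivityFromMeasures.

Unset Implicit Arguments.
Set Strict Implicit.
Set Printing Implicit Defensive.

Theorem theorem4p1 (R : realType) (n : nat) (K : set 'rV[R]_n)
  (V : lmodType R) (ip : V -> V -> R) (J : option (V -> V))
  (T : opoly V n -> opoly V n) :
  compact K ->
  hilbert_space ip J ->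
  (* T is a real-linear operator on B(H)_h (x) R[x_1..x_n] *)
  (forall p, is_opoly ip J p -> is_opoly ip J (T p)) ->
  (forall c p q, is_opoly ip J p -> is_opoly ip J q ->
     T (opadd (opscale c p) q) = opadd (opscale c (T p)) (T q)) ->
  ((forall p, Pos ip J K p -> Pos ip J K (T p)) <->
   (forall y, K y ->
      exists nu : set (Borel R n) -> (V -> V) -> (V -> V),
        pos_map_valued_measure ip J (translate K y) nu /\
        forall (A : V -> V) (be : mindex n), Bh ip J A -> forall v : V,
          is_signed_integral (translate K y) (fun S => ip (nu S A v) v)
            (fun t : Borel R n => monom t be)
            (ip (opeval (Qcan T be A) y v) v))).
Proof.
move=> cK hV Topoly Tlin; split=> [Tpos y Ky|hnu p hp].
  exact: (map_valued_measure_exists hV Topoly Tlin cK Ky Tpos).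
split=> [|y Ky]; first by apply: Topoly; case: hp.
have [nu [posnu intnu]] := hnu y Ky.
exact: (psd_opeval_of_measure hV cK posnu Topoly Tlin intnu hp).
Qed.
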